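(* There is an absolute constant $C>0$ such that for all integers $T\ge 2$ and $d\ge 1$ there exists an efficient forecasting algorithm for the $T$-round online protocol with context space $\mathcal X=\{x\in\mathbb R^d:\|x\|_2\le 1,\ x_1=\tfrac12\}$ (making predictions in $\mathcal Z=\{0,\frac1N,\dots,\frac{N-1}{N},1\}$ for a suitable positive integer $N$ chosen by the algorithm) such that, for every oblivious adversary and every $\delta\in(0,1)$, with probability at least $1-\delta$, $$\mathsf{SOmni}_{\mathcal L^{\mathrm{cvx}},\mathcal F^{\mathrm{aff}}_{\mathrm{res}}}\le C\left(T^{\frac23}d^{\frac13}(\log T)^{\frac13}+T^{\frac23}(d\log T)^{-\frac16}\sqrt{\log\frac1\delta}\right).$$ Furthermore, $\mathbb E\big[\mathsf{SOmni}_{\mathcal L^{\mathrm{cvx}},\mathcal F^{\mathrm{aff}}_{\mathrm{res}}}\big]\le C\,T^{\frac23}d^{\frac13}(\log T)^{\frac13}$, where the expectation is over the internal randomness of the algorithm.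
   Context: Online protocol. There are $T$ rounds ($T$ known). An oblivious adversary fixes a sequence $(x_1,y_1),\dots,(x_T,y_T)\in\mathcal X\times\{0,1\}$ in advance (knowing the forecaster's algorithm but not its random draws). In round $t$: the context $x_t$ is revealed; the forecaster chooses a distribution $\mathcal P_t$ on $\mathcal Z$ and draws a prediction $p_t\sim\mathcal P_t$; then $y_t$ is revealed. Losses. $\mathcal L^{\mathrm{cvx}}$ is the class of functions $\ell:[0,1]\times\{0,1\}\to[-1,1]$ such that for each $y\in\{0,1\}$ the map $p\mapsto\ell(p,y)$ is convex and $1$-Lipschitz. For a loss $\ell$, the post-processing function $k_\ell:[0,1]\to[0,1]$ is the best response $k_\ell(q)\in\arg\min_{p\in[0,1]}\mathbb E_{y\sim\mathrm{Ber}(q)}[\ell(p,y)]$ (with an arbitrary fixed tie-breaking). Hypotheses. $\mathcal F^{\mathrm{aff}}_{\mathrm{res}}=\{x\mapsto\frac{1+\langle\theta,x\rangle}{2}:\theta\in\mathbb R^d,\ \|\theta\|_2\le 1\}$. Swap omniprediction error: $$\mathsf{SOmni}_{\mathcal L,\mathcal F}=\sup_{\{\ell_p\in\mathcal L,\,f_p\in\mathcal F\}_{p\in\mathcal Z}}\ \sum_{t=1}^T\Big(\ell_{p_t}\big(k_{\ell_{p_t}}(p_t),y_t\big)-\ell_{p_t}\big(f_{p_t}(x_t),y_t\big)\Big).$$ ''Efficient'' means running time polynomial in $T$ and $d$. *)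

(* Defs.v *)
From HB Require Import structures.
From mathcomp Require Import all_boot all_order all_algebra.
From mathcomp Require Import all_classical all_reals all_analysis.
Import Order.TTheory GRing.Theory Num.Theory.
Import numFieldNormedType.Exports.

Set Implicit Arguments.
Unset Strict Implicit.
Unset Printing Implicit Defensive.

Local Open Scope classical_set_scope.
Local Open Scope ring_scope.

(** * Real RAM

   Algorithms are programs of a structured real RAM: integer registers, named
   arrays of reals addressed by tuples of integers, field operations and
   comparisons on reals at unit cost. Programs contain no real literals, so a
   program is a finite object that does not depend on the inputs. There is no
   conversion from reals to integers and no integer multiplication; hence a
   polynomial number of steps only creates integers of polynomial bit length.
   The only loops have a bound evaluated on entry, so that every program
   terminates; their cost still counts every iteration. *)

Inductive nexp : Type :=
  | NConst of nat
  | NReg of nat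
  | NAdd of nexp & nexp
  | NSub of nexp & nexp.                  (* truncated *)

Inductive rexp : Type :=
  | RNat of nexp
  | RCell of nat & seq nexp
  | RAdd of rexp & rexp
  | RSub of rexp & rexp
  | RMul of rexp & rexp
  | RDiv of rexp & rexp.                  (* x / 0 = 0 *)

Inductive bexp : Type :=
  | BLeN of nexp & nexp
  | BLeR of rexp & rexp
  | BNot of bexp
  | BAnd of bexp & bexp.

Inductive cmd : Type :=
  | CSkip
  | CSetN of nat & nexp
  | CSetR of nat & seq nexp & rexp
  | CSeq of cmd & cmd
  | CIf of bexp & cmd & cmd
  | CFor of nat & nexp & cmd.             (* for r = 0, ..., e - 1 do c *)

Record state (R : realType) := State {
  nmem : nat -> nat;
  rmem : nat -> seq nat -> R }.

Definition set_nat (R : realType) (s : state R) (r v : nat) : state R :=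
  State (fun r' => if r' == r then v else nmem s r') (rmem s).

Definition set_real (R : realType) (s : state R) (a : nat) (ix : seq nat)
    (v : R) : state R :=
  State (nmem s)
    (fun a' ix' => if (a' == a) && (ix' == ix) then v else rmem s a' ix').

Fixpoint neval (R : realType) (s : state R) (e : nexp) : nat :=
  match e with
  | NConst k => k
  | NReg r => nmem s r
  | NAdd e1 e2 => (neval s e1 + neval s e2)%N
  | NSub e1 e2 => (neval s e1 - neval s e2)%N
  end.

Fixpoint reval (R : realType) (s : state R) (e : rexp) : R :=
  match e with
  | RNat e1 => (neval s e1)%:R
  | RCell a ix => rmem s a (map (neval s) ix)
  | RAdd e1 e2 => reval s e1 + reval s e2
  | RSub e1 e2 => reval s e1 - reval s e2
  | RMul e1 e2 => reval s e1 * reval s e2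
  | RDiv e1 e2 => reval s e1 / reval s e2
  end.

Fixpoint beval (R : realType) (s : state R) (b : bexp) : bool :=
  match b with
  | BLeN e1 e2 => (neval s e1 <= neval s e2)%N
  | BLeR e1 e2 => reval s e1 <= reval s e2
  | BNot b1 => ~~ beval s b1
  | BAnd b1 b2 => beval s b1 && beval s b2
  end.

Fixpoint exec (R : realType) (c : cmd) (s : state R) : state R :=
  match c with
  | CSkip => s
  | CSetN r e => set_nat s r (neval s e)
  | CSetR a ix e => set_real s a (map (neval s) ix) (reval s e)
  | CSeq c1 c2 => exec c2 (exec c1 s)
  | CIf b c1 c2 => if beval s b then exec c1 s else exec c2 s
  | CFor r e c1 => iteri (neval s e) (fun k s' => exec c1 (set_nat s' r k)) s
  end.

Fixpoint nsize (e : nexp) : nat :=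
  match e with
  | NConst _ | NReg _ => 1
  | NAdd e1 e2 | NSub e1 e2 => (nsize e1 + nsize e2).+1
  end.

Fixpoint rsize (e : rexp) : nat :=
  match e with
  | RNat e1 => (nsize e1).+1
  | RCell _ ix => (sumn (map nsize ix)).+1
  | RAdd e1 e2 | RSub e1 e2 | RMul e1 e2 | RDiv e1 e2 =>
      (rsize e1 + rsize e2).+1
  end.

Fixpoint bsize (b : bexp) : nat :=
  match b with
  | BLeN e1 e2 => (nsize e1 + nsize e2).+1
  | BLeR e1 e2 => (rsize e1 + rsize e2).+1
  | BNot b1 => (bsize b1).+1
  | BAnd b1 b2 => (bsize b1 + bsize b2).+1
  end.

(* Number of elementary steps performed by [exec c s]. *)
Fixpoint cost (R : realType) (c : cmd) (s : state R) : nat :=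
  match c with
  | CSkip => 1
  | CSetN _ e => (nsize e).+1
  | CSetR _ ix e => (sumn (map nsize ix) + rsize e).+1
  | CSeq c1 c2 => (cost c1 s + cost c2 (exec c1 s)).+1
  | CIf b c1 c2 => (bsize b + (if beval s b then cost c1 s else cost c2 s)).+1
  | CFor r e c1 =>
      let before k := iteri k (fun j s' => exec c1 (set_nat s' r j)) s in
      (nsize e + \sum_(k < neval s e) (cost c1 (set_nat (before k) r k)).+1).+1
  end.

(** * Forecasters and the online protocol *)

Record forecaster := Forecaster {
  initialize : cmd;
  predict : cmd;      (* run after the context is revealed *)
  update : cmd }.     (* run after the draw and the outcome are revealed *)

(* Input/output conventions. The forecaster finds T, d, the index i of the
   drawn prediction i / N and the outcome in registers, and the context x_t in
   the cells [:: 0], ..., [:: d - 1] of an array; it stores N in a register and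
   the probabilities of the predictions 0 / N, ..., N / N in the cells [:: 0],
   ..., [:: N] of another array. *)
Definition reg_T : nat := 0.
Definition reg_d : nat := 1.
Definition reg_N : nat := 2.
Definition reg_draw : nat := 3.
Definition reg_outcome : nat := 4.
Definition arr_context : nat := 0.
Definition arr_weights : nat := 1.

Definition start_state (R : realType) (T d : nat) : state R :=
  set_nat (set_nat (State (fun=> 0%N) (fun _ _ => 0)) reg_T T) reg_d d.

Definition initial_state (R : realType) (A : forecaster) (T d : nat) : state R :=
  exec (initialize A) (start_state R T d).

Definition grid_size (R : realType) (A : forecaster) (T d : nat) : nat :=
  nmem (initial_state R A T d) reg_N.

Definition load_context (R : realType) (d : nat) (x : 'rV[R]_d) (s : state R) :
    state R :=
  State (nmem s) (fun a ix =>
    match ix with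
    | [:: j] =>
        if a == arr_context then oapp (x 0) (rmem s a ix) (insub j)
        else rmem s a ix
    | _ => rmem s a ix
    end).

Definition load_feedback (R : realType) (i : nat) (y : bool) (s : state R) :
    state R :=
  set_nat (set_nat s reg_draw i) reg_outcome y.

Definition after_predict (R : realType) (A : forecaster) (d : nat)
    (s : state R) (x : 'rV[R]_d) : state R :=
  exec (predict A) (load_context x s).

Definition after_round (R : realType) (A : forecaster) (d : nat)
    (s : state R) (r : 'rV[R]_d * bool * nat) : state R :=
  exec (update A) (load_feedback r.2 r.1.2 (after_predict A s r.1.1)).

(* An oblivious adversary is a sequence [e] of pairs (x_t, y_t); [p] is the
   sequence of indices drawn by the forecaster. The state before round [t]
   depends on the first [t] entries of [e] and [p] only. *)
Definition state_before (R : realType) (A : forecaster) (T d n : nat)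
    (e : T.-tuple ('rV[R]_d * bool)) (p : T.-tuple 'I_n.+1) (t : nat) : state R :=
  foldl (@after_round R A d) (initial_state R A T d)
    (take t (zip e (map val p))).

(* The distribution P_t, as the function giving the probability of i / n. *)
Definition round_dist (R : realType) (A : forecaster) (T d n : nat)
    (e : T.-tuple ('rV[R]_d * bool)) (p : T.-tuple 'I_n.+1) (t : 'I_T)
    (i : 'I_n.+1) : R :=
  rmem (after_predict A (state_before A e p t) (tnth e t).1)
    arr_weights [:: val i].

(* Law of the sequence of draws, p_t being drawn from P_t given p_1, ..,
   p_(t-1). *)
Definition draw_prob (R : realType) (A : forecaster) (T d n : nat)
    (e : T.-tuple ('rV[R]_d * bool)) (p : T.-tuple 'I_n.+1) : R :=
  \prod_(t < T) round_dist A e p t (tnth p t).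

Definition Prob (R : realType) (A : forecaster) (T d n : nat)
    (e : T.-tuple ('rV[R]_d * bool)) (E : pred (T.-tuple 'I_n.+1)) : R :=
  \sum_(p | E p) draw_prob A e p.

Definition Expect (R : realType) (A : forecaster) (T d n : nat)
    (e : T.-tuple ('rV[R]_d * bool)) (X : T.-tuple 'I_n.+1 -> \bar R) : \bar R :=
  (\sum_p (draw_prob A e p)%:E * X p)%E.

(** * Contexts and hypotheses *)

(* MathComp-Analysis's norm on matrices is the sup norm. *)
Definition dotp (R : realType) (d : nat) (u v : 'rV[R]_d) : R :=
  \sum_(j < d) u 0 j * v 0 j.

Definition norm2 (R : realType) (d : nat) (u : 'rV[R]_d) : R :=
  Num.sqrt (dotp u u).

Definition context_space (R : realType) (d : nat) : set 'rV[R]_d :=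
  [set x | norm2 x <= 1 /\ forall j : 'I_d, val j = 0%N -> x 0 j = 2^-1].

Definition Faff_res (R : realType) (d : nat) : set ('rV[R]_d -> R) :=
  [set (fun x => (1 + dotp theta x) / 2) | theta in [set theta | norm2 theta <= 1]].

Definition admissible (R : realType) (T d : nat)
    (e : T.-tuple ('rV[R]_d * bool)) : Prop :=
  forall t : 'I_T, context_space (tnth e t).1.

(** * Well-formed and efficient forecasters *)

Definition outputs_distributions (R : realType) (A : forecaster) (T d n : nat)
    (e : T.-tuple ('rV[R]_d * bool)) : Prop :=
  forall (p : T.-tuple 'I_n.+1) (t : 'I_T),
    (forall i, 0 <= round_dist A e p t i) /\ \sum_i round_dist A e p t i = 1.

(* Every round is also charged d for reading x_t and n + 1 for sampling p_t. *)
Definition running_time (R : realType) (A : forecaster) (T d n : nat)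
    (e : T.-tuple ('rV[R]_d * bool)) (p : T.-tuple 'I_n.+1) : nat :=
  (cost (initialize A) (start_state R T d)
   + \sum_(t < T)
       (let s := state_before A e p t in
        let x := (tnth e t).1 in
        let s' := load_feedback (tnth p t) (tnth e t).2 (after_predict A s x) in
        d + cost (predict A) (load_context x s) + n.+1 + cost (update A) s'))%N.

(* Worst case over contexts, outcomes and draws; the same program serves all
   T and d. *)
Definition efficient (R : realType) (A : forecaster) : Prop :=
  exists c k : nat, forall T d : nat, (2 <= T)%N -> (1 <= d)%N ->
  forall (e : T.-tuple ('rV[R]_d * bool))
         (p : T.-tuple 'I_(grid_size R A T d).+1),
    admissible e -> (running_time A e p <= c * (T + d) ^ k)%N.

(** * Losses and swap omniprediction error *)

Definition unit_itv (R : realType) : set R := `[0, 1].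

(* A loss is only constrained, and only evaluated, on [0, 1] * {0, 1}. *)
Definition Lcvx (R : realType) : set (R -> bool -> R) :=
  [set l | (forall q y, unit_itv q -> -1 <= l q y <= 1) /\
           forall y, @convex_function R R^o (@unit_itv R) (l^~ y) /\
                     1.-lipschitz_(@unit_itv R) (l^~ y : R^o -> R^o)].

Definition expected_loss (R : realType) (l : R -> bool -> R) (q p : R) : R :=
  \sum_(y : bool) bernoulli_pmf q y * l p y.

(* [k l] is the post-processing function of [l]; [k] embodies the
   tie-breaking rule. *)
Definition best_response (R : realType) (L : set (R -> bool -> R))
    (k : (R -> bool -> R) -> R -> R) : Prop :=
  forall l, L l -> forall q, unit_itv q ->
    unit_itv (k l q) /\
    forall p, unit_itv p -> expected_loss l q (k l q) <= expected_loss l q p.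

(* Families indexed by the grid {0, 1/n, ..., 1} are indexed by 'I_n.+1. *)
Definition SOmni (R : realType) (T d n : nat) (L : set (R -> bool -> R))
    (F : set ('rV[R]_d -> R)) (k : (R -> bool -> R) -> R -> R)
    (e : T.-tuple ('rV[R]_d * bool)) (p : T.-tuple 'I_n.+1) : \bar R :=
  ereal_sup
    [set (\sum_(t < T)
            (let i := tnth p t in let: (x, y) := tnth e t in
             lf.1 i (k (lf.1 i) ((val i)%:R / n%:R)) y
             - lf.1 i (lf.2 i x) y))%:E
    | lf in [set lf : ('I_n.+1 -> R -> bool -> R) * ('I_n.+1 -> 'rV[R]_d -> R)
            | (forall i, L (lf.1 i)) /\ (forall i, F (lf.2 i))]].

(* Main.v *)
(** The regret of a loss-hypothesis pair on the rounds predicting [i / N] is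
    at most a constant times the norm of [V_i], the sum of
    [(y_t - i / N) x_t] over these rounds: losses are affine in the outcome,
    and by convexity a hypothesis is beaten by its mean up to its covariance
    with the outcomes. So it suffices to control the sum of the norms of the
    [V_i].

    With [n_i] the number of these rounds and [K = T / (N + 1)], take the
    potential [sum_i |V_i|^2 / (n_i + K)]; unlike [sum_i |V_i|] it needs no
    square roots, so the real RAM can follow its gradient exactly. Put
    [g_i = <V_i, x> / (n_i + K + 1)]. When [i] is drawn the potential grows by
    at most [2 g_i (y - i / N) - g_i^2 + 1 / K]. The forecaster
    randomizes between two neighbours where [g] changes sign, so that [g] has
    mean zero and the first term is [O(1 / N)] times the mean of [|g|]. The
    negative square absorbs both this drift and the variance: the exponential
    of a small constant times the potential is, up to a deterministic factor,
    a supermartingale. Hence the potential is at most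
    [N + 1 + T / (2 N^2) + O(log (1 / delta))], and AM-GM turns this into a
    bound on the norms; [N] is about [(T / (d log T))^(1/3)]. *)
Require Import Defs.
From mathcomp Require Import all_boot all_order all_algebra.
From mathcomp Require Import all_classical all_reals all_analysis.
From mathcomp Require Import zify ring lra.
Import Order.TTheory GRing.Theory Num.Theory.
Import numFieldNormedType.Exports.

Set Implicit Arguments.
Unset Strict Implicit.
Unset Printing Implicit Defensive.

Local Open Scope ring_scope.

Lemma iteri_invariant (S : Type) (P : nat -> S -> Prop) (f : nat -> S -> S)
    (n : nat) (s : S) :
  P 0%N s -> (forall k s', (k < n)%N -> P k s' -> P k.+1 (f k s')) ->
  P n (iteri n f s).
Proof.
move=> P0; elim: n => [//|n IH] Pf /=; apply: (Pf n) => //.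
by apply: IH => k s' kn; apply: Pf; apply: ltnW.
Qed.

(** * Frames and costs of programs *)

(** Syntactic over-approximation of the registers a program writes, so that frame conditions on
    concrete programs are settled by computation. *)
Fixpoint sets_reg (r : nat) (c : cmd) : bool :=
  match c with
  | CSkip | CSetR _ _ _ => false
  | CSetN r' _ => r' == r
  | CSeq c1 c2 | CIf _ c1 c2 => sets_reg r c1 || sets_reg r c2
  | CFor r' _ c1 => (r' == r) || sets_reg r c1
  end.

Fixpoint sets_arr (a : nat) (c : cmd) : bool :=
  match c with
  | CSkip | CSetN _ _ => false
  | CSetR a' _ _ => a' == a
  | CSeq c1 c2 | CIf _ c1 c2 => sets_arr a c1 || sets_arr a c2
  | CFor _ _ c1 => sets_arr a c1
  end.

Lemma exec_reg (R : realType) (r : nat) (c : cmd) (s : state R) :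
  ~~ sets_reg r c -> nmem (exec c s) r = nmem s r.
Proof.
elim: c s => [|r' e|a ix e|c1 IH1 c2 IH2|b c1 IH1 c2 IH2|r' e c1 IH] s //=.
- by rewrite eq_sym => /negbTE ->.
- by rewrite negb_or => /andP[h1 h2]; rewrite IH2 // IH1.
- by rewrite negb_or => /andP[h1 h2]; case: ifP => _; [apply: IH1|apply: IH2].
- rewrite negb_or eq_sym => /andP[/negbTE rr' h1].
  apply: (@iteri_invariant _ (fun _ s' => nmem s' r = nmem s r)) => // k s' _ h.
  by rewrite IH //= rr'.
Qed.

Lemma exec_arr (R : realType) (a : nat) (c : cmd) (s : state R) :
  ~~ sets_arr a c -> rmem (exec c s) a = rmem s a.
Proof.
elim: c s => [|r' e|a' ix e|c1 IH1 c2 IH2|b c1 IH1 c2 IH2|r' e c1 IH] s //=.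
- by rewrite eq_sym => /negbTE ->; apply/funext.
- by rewrite negb_or => /andP[h1 h2]; rewrite IH2 // IH1.
- by rewrite negb_or => /andP[h1 h2]; case: ifP => _; [apply: IH1|apply: IH2].
- move=> h1.
  apply: (@iteri_invariant _ (fun _ s' => rmem s' a = rmem s a)) => // k s' _ h.
  by rewrite IH.
Qed.

(** * Polynomial cost bounds read off the syntax *)

Fixpoint regs_in (rs : seq nat) (e : nexp) : bool :=
  match e with
  | NConst _ => true
  | NReg r => r \in rs
  | NAdd e1 e2 | NSub e1 e2 => regs_in rs e1 && regs_in rs e2
  end.

(** A coefficient for a linear bound on the value in terms of the largest register read; truncated
    subtraction never exceeds its first operand. *)
Fixpoint nscale (e : nexp) : nat :=
  match e with
  | NConst k => k
  | NReg _ => 1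
  | NAdd e1 e2 => (nscale e1 + nscale e2)%N
  | NSub e1 e2 => nscale e1
  end.

(** Loop bounds depend only on the registers [rs], and these are never written; hence every loop
    bound is controlled by the values of [rs] at the start. *)
Fixpoint loops_over (rs : seq nat) (c : cmd) : bool :=
  match c with
  | CSkip | CSetR _ _ _ => true
  | CSetN r _ => r \notin rs
  | CSeq c1 c2 | CIf _ c1 c2 => loops_over rs c1 && loops_over rs c2
  | CFor r e c1 => [&& r \notin rs, regs_in rs e & loops_over rs c1]
  end.

Fixpoint cost_scale (c : cmd) : nat :=
  match c with
  | CSkip => 1
  | CSetN _ e => (nsize e).+1
  | CSetR _ ix e => (sumn (map nsize ix) + rsize e).+1
  | CSeq c1 c2 => (cost_scale c1 + cost_scale c2).+1
  | CIf b c1 c2 => (bsize b + (cost_scale c1 + cost_scale c2)).+1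
  | CFor _ e c1 => (nsize e + nscale e * (cost_scale c1).+1).+1
  end.

(** A crude degree: it adds up over sequences and branches instead of taking the maximum, which is
    enough for a polynomial bound. *)
Fixpoint cost_depth (c : cmd) : nat :=
  match c with
  | CSkip | CSetN _ _ | CSetR _ _ _ => 0
  | CSeq c1 c2 | CIf _ c1 c2 => (cost_depth c1 + cost_depth c2)%N
  | CFor _ _ c1 => (cost_depth c1).+1
  end.

Lemma loops_over_sets (rs : seq nat) (c : cmd) (r : nat) :
  loops_over rs c -> r \in rs -> ~~ sets_reg r c.
Proof.
move=> + rin; elim: c => [|r' e|a ix e|c1 IH1 c2 IH2|b c1 IH1 c2 IH2|r' e c1 IH] //=.
- by apply: contra => /eqP ->.
- by move=> /andP[/IH1 h1 /IH2 h2]; rewrite negb_or h1.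
- by move=> /andP[/IH1 h1 /IH2 h2]; rewrite negb_or h1.
- move=> /and3P[h1 _ /IH h2]; rewrite negb_or h2 andbT.
  by apply: contra h1 => /eqP ->.
Qed.

Lemma neval_le (R : realType) (rs : seq nat) (e : nexp) (s : state R) (M : nat) :
  (0 < M)%N -> (forall r, r \in rs -> (nmem s r <= M)%N) -> regs_in rs e ->
  (neval s e <= nscale e * M)%N.
Proof.
move=> M0 sM; elim: e => [k|r|e1 IH1 e2 IH2|e1 IH1 e2 IH2] /=.
- by move=> _; apply: leq_pmulr.
- by rewrite mul1n; apply: sM.
- by move=> /andP[/IH1 h1 /IH2 h2]; rewrite mulnDl leq_add.
- by move=> /andP[/IH1 h1 _]; apply: leq_trans h1; apply: leq_subr.
Qed.

(** Each loop makes at most [nscale e * M] iterations, since the registers [rs] stay fixed, so each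
    level of nesting costs one more factor [M]. *)
Lemma cost_le (R : realType) (rs : seq nat) (c : cmd) (s : state R) (M : nat) :
  loops_over rs c -> (0 < M)%N ->
  (forall r, r \in rs -> (nmem s r <= M)%N) ->
  (cost c s <= cost_scale c * M ^ cost_depth c)%N.
Proof.
move=> + M0.
have Mp k : (0 < M ^ k)%N by rewrite expn_gt0 M0.
have widen u v k k' : (k <= k')%N -> (u <= v * M ^ k -> u <= v * M ^ k')%N.
  move=> kk' /leq_trans; apply; rewrite leq_mul2l leq_pexp2l ?orbT //.
elim: c s => [|r' e|a ix e|c1 IH1 c2 IH2|b c1 IH1 c2 IH2|r' e c1 IH] s /=;
  rewrite ?expn0 ?muln1 //.
- move=> /andP[g1 g2] sM.
  have h1 := widen _ _ _ (cost_depth c1 + cost_depth c2)%N (leq_addr _ _) (IH1 s g1 sM).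
  have sM' r : r \in rs -> (nmem (exec c1 s) r <= M)%N.
    by move=> rr; rewrite exec_reg ?sM //; apply: loops_over_sets g1 rr.
  have h2 := widen _ _ _ (cost_depth c1 + cost_depth c2)%N (leq_addl _ _) (IH2 _ g2 sM').
  by rewrite mulSn mulnDl; have := Mp (cost_depth c1 + cost_depth c2)%N; lia.
- move=> /andP[g1 g2] sM.
  have h1 := widen _ _ _ (cost_depth c1 + cost_depth c2)%N (leq_addr _ _) (IH1 s g1 sM).
  have h2 := widen _ _ _ (cost_depth c1 + cost_depth c2)%N (leq_addl _ _) (IH2 s g2 sM).
  have := Mp (cost_depth c1 + cost_depth c2)%N.
  have := leq_pmulr (bsize b) (Mp (cost_depth c1 + cost_depth c2)%N).
  by rewrite mulSn !mulnDl; case: ifP => _; lia.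
- move=> /and3P[r'rs ers g1] sM.
  have body k : (k < neval s e)%N ->
      (cost c1 (set_nat (iteri k (fun j s' => exec c1 (set_nat s' r' j)) s) r' k)
       <= cost_scale c1 * M ^ cost_depth c1)%N.
    move=> _; apply: IH => // r rr /=; case: eqP => [rr'|_].
      by move: r'rs; rewrite -rr' rr.
    apply: (@iteri_invariant _ (fun _ s' => (nmem s' r <= M)%N)) => [|j s' _ h].
      exact: sM.
    rewrite exec_reg /=; last exact: loops_over_sets g1 rr.
    by case: eqP => // rr'; move: r'rs; rewrite -rr' rr.
  have : (\sum_(k < neval s e) (cost c1 (set_nat (iteri k (fun j s' =>
       exec c1 (set_nat s' r' j)) s) r' k)).+1
     <= \sum_(k < neval s e) (cost_scale c1 * M ^ cost_depth c1).+1)%N.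
    by apply: leq_sum => k _; rewrite ltnS; apply: body.
  rewrite sum_nat_const card_ord => h.
  have {h} := leq_trans h (leq_mul (neval_le M0 sM ers)
    (_ : _ <= (cost_scale c1).+1 * M ^ cost_depth c1)%N).
  rewrite mulSn addnC -addn1 leq_add2l => /(_ (Mp _)) h.
  apply: (@leq_trans ((nsize e) + nscale e * M * ((cost_scale c1).+1 * M ^ cost_depth c1)).+1).
    by rewrite ltnS leq_add2l mulSn addnC.
  rewrite expnS mulnACA.
  have := Mp (cost_depth c1).+1; rewrite expnS => P.
  have h2 := leq_pmulr (nsize e) P.
  by rewrite [X in (_ <= X)%N]mulSn mulnDl; lia.
Qed.


(** * Vectors and one-step inequalities *)

Lemma dotpC (R : realType) (d : nat) (u v : 'rV[R]_d) : dotp u v = dotp v u.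
Proof. by apply: eq_bigr => j _; rewrite mulrC. Qed.

Lemma dotpDl (R : realType) (d : nat) (u v w : 'rV[R]_d) :
  dotp (u + v) w = dotp u w + dotp v w.
Proof. by rewrite -big_split; apply: eq_bigr => j _; rewrite mxE mulrDl. Qed.

Lemma dotpZl (R : realType) (d : nat) (a : R) (u w : 'rV[R]_d) :
  dotp (a *: u) w = a * dotp u w.
Proof. by rewrite mulr_sumr; apply: eq_bigr => j _; rewrite mxE mulrA. Qed.

Lemma dotpDr (R : realType) (d : nat) (u v w : 'rV[R]_d) :
  dotp w (u + v) = dotp w u + dotp w v.
Proof. by rewrite !(dotpC w) dotpDl. Qed.

Lemma dotpZr (R : realType) (d : nat) (a : R) (u w : 'rV[R]_d) :
  dotp w (a *: u) = a * dotp w u.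
Proof. by rewrite !(dotpC w) dotpZl. Qed.

Lemma dotp0l (R : realType) (d : nat) (w : 'rV[R]_d) : dotp 0 w = 0.
Proof. by rewrite -(scale0r 0) dotpZl mul0r. Qed.

Lemma dotp_sumr (R : realType) (d : nat) (I : finType) (P : pred I)
    (u : I -> 'rV[R]_d) (w : 'rV[R]_d) :
  dotp w (\sum_(i | P i) u i) = \sum_(i | P i) dotp w (u i).
Proof.
apply: (big_morph (dotp w)) => [u1 u2|]; first exact: dotpDr.
by rewrite dotpC dotp0l.
Qed.

Lemma dotp_ge0 (R : realType) (d : nat) (u : 'rV[R]_d) : 0 <= dotp u u.
Proof. by apply: sumr_ge0 => j _; rewrite -expr2 sqr_ge0. Qed.

Lemma norm2_le1 (R : realType) (d : nat) (u : 'rV[R]_d) :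
  norm2 u <= 1 -> dotp u u <= 1.
Proof.
move=> h; rewrite -[dotp u u]sqr_sqrtr ?dotp_ge0 //.
by rewrite expr_le1 // sqrtr_ge0.
Qed.

(** Cauchy-Schwarz against a vector of norm at most 1, obtained by expanding
    [|u - <u, x> x|^2 >= 0]. *)
Lemma dotp_sqr_le (R : realType) (d : nat) (u x : 'rV[R]_d) :
  dotp x x <= 1 -> dotp u x ^+ 2 <= dotp u u.
Proof.
move=> x1; have := dotp_ge0 (u + (- dotp u x) *: x).
rewrite !(dotpDl, dotpDr, dotpZl, dotpZr) (dotpC x u) => h.
have : dotp u x ^+ 2 * dotp x x <= dotp u x ^+ 2.
  by rewrite ler_piMr // sqr_ge0.
by move: h; lra.
Qed.

Lemma dotp_le_norm2 (R : realType) (d : nat) (u x : 'rV[R]_d) :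
  norm2 x <= 1 -> `|dotp u x| <= norm2 u.
Proof.
move=> /norm2_le1 x1; rewrite -ler_sqr ?nnegrE ?sqrtr_ge0 ?normr_ge0 //.
by rewrite sqr_sqrtr ?dotp_ge0 // real_normK ?num_real // dotp_sqr_le.
Qed.

Lemma coord_le_norm2 (R : realType) (d : nat) (u : 'rV[R]_d) (j : 'I_d) :
  `|u 0 j| <= norm2 u.
Proof.
rewrite -ler_sqr ?nnegrE ?sqrtr_ge0 ?normr_ge0 //.
rewrite sqr_sqrtr ?dotp_ge0 // real_normK ?num_real //.
rewrite /dotp (bigD1 j) //= -expr2 lerDl.
by apply: sumr_ge0 => k _; rewrite -expr2 sqr_ge0.
Qed.

(** * Inequalities for one round of the potential argument *)

(** From [exp (- z) >= 1 - z] one gets [exp z <= 1 / (1 - z)], and [(1 + z + 2 z^2) (1 - z) = 1 +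
    z^2 (1 - 2 z) >= 1]. *)
Lemma expR_quadratic (R : realType) (z : R) :
  z <= 1 / 2 -> expR z <= 1 + z + 2 * z ^+ 2.
Proof.
move=> z2; have z1 : 0 < 1 - z by lra.
have h : expR z <= (1 - z)^-1.
  rewrite -[expR z]invrK -expRN lef_pV2 ?posrE ?expR_gt0 //.
  by have := expR_ge1Dx (- z); lra.
apply: le_trans h _; rewrite -div1r ler_pdivrMr //.
have -> : (1 + z + 2 * z ^+ 2) * (1 - z) = 1 + z ^+ 2 * (1 - 2 * z) by ring.
by rewrite lerDl mulr_ge0 ?sqr_ge0 //; lra.
Qed.

(* The second-order term of the exponential is absorbed by [- g i ^+ 2]; this
   is what makes a constant rate 1/36 possible. *)
Lemma mixed_exponential (R : realType) (I : finType) (w g r : I -> R) (m : R) :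
  (forall i, 0 <= w i) -> \sum_i w i = 1 ->
  (forall i, `|g i| <= 1) -> (forall i, `|r i| <= 1) ->
  \sum_i w i * (g i * r i) <= (\sum_i w i * g i ^+ 2 + m) / 4 ->
  \sum_i w i * expR ((2 * (g i * r i) - g i ^+ 2) / 36) <= expR (m / 72).
Proof.
move=> w0 w1 g1 r1 drift.
(* With [u = 2 g r - g^2] one has [|u| <= 3 |g|], so the quadratic term [2 (u / 36)^2] is at most
   [g^2 / 72]: half of the linear gain [g^2 / 36]. The other half remains to absorb the drift. *)
apply: (@le_trans _ _ (\sum_i (w i + (w i * (g i * r i)) / 18
                                 - (w i * g i ^+ 2) / 72))).
  apply: ler_sum => i _.
  have -> : w i + (w i * (g i * r i)) / 18 - (w i * g i ^+ 2) / 72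
    = w i * (1 + g i * r i / 18 - g i ^+ 2 / 72) by field.
  apply: ler_wpM2l => //.
  set u := 2 * (g i * r i) - g i ^+ 2.
  have gi := g1 i; have ri := r1 i.
  have r2 : r i ^+ 2 <= 1.
    by rewrite -real_normK ?num_real // expr_le1.
  have g2 : g i ^+ 2 <= 1.
    by rewrite -real_normK ?num_real // expr_le1.
  have gr : `|g i * r i| <= `|g i| by rewrite normrM ler_piMr.
  have un : `|u| <= 3 * `|g i|.
    apply: le_trans (ler_normB _ _) _.
    rewrite normrM (ger0_norm (_ : 0 <= 2 :> R)) // normrX.
    have : `|g i| ^+ 2 <= `|g i| by rewrite expr2 ler_piMr.
    by lra.
  have u2 : u ^+ 2 <= 9 * g i ^+ 2.
    rewrite -real_normK ?num_real //.
    rewrite -[g i ^+ 2]real_normK ?num_real //.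
    have -> : 9 * `|g i| ^+ 2 = (3 * `|g i|) ^+ 2 by ring.
    by rewrite ler_sqr ?nnegrE ?mulr_ge0.
  have ule : u / 36 <= 1 / 2.
    have := ler_norm u; lra.
  apply: le_trans (expR_quadratic ule) _.
  have -> : 2 * (u / 36) ^+ 2 = u ^+ 2 / 648 by field.
  by move: u2; rewrite /u; lra.
rewrite sumrB big_split /= -!mulr_suml w1.
by apply: le_trans (expR_ge1Dx _); move: drift; lra.
Qed.

(* The weights cancel the mean of [g] over [p] and [q], so the drift comes only
   from their distance [1 / n]. *)
Lemma crossing_drift (R : realType) (a b w1 w2 p q y n : R) :
  0 < a -> b <= 0 -> 0 < n -> q = p + 1 / n ->
  w1 = - b / (a - b) -> w2 = a / (a - b) ->
  w1 * (a * (y - p)) + w2 * (b * (y - q))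
    <= (w1 * a ^+ 2 + w2 * b ^+ 2 + n ^- 2) / 4.
Proof.
move=> a0 b0 n0 -> -> ->; set c := n^-1.
have ab : 0 < a - b by lra.
rewrite div1r -/c -exprVn -/c.
have -> : - b / (a - b) * (a * (y - p)) + a / (a - b) * (b * (y - (p + c)))
   = (a * - b / (a - b)) * c by field; rewrite gt_eqF.
have -> : - b / (a - b) * a ^+ 2 + a / (a - b) * b ^+ 2 = a * - b.
  by field; rewrite gt_eqF.
(* The drift is [m c] and the second moment is [a (- b)], which dominates [4 m^2] because
   [4 a (- b) <= (a - b)^2]. Then [(2 m - c)^2 >= 0] concludes. *)
set m := a * - b / (a - b).
have m2 : 4 * m ^+ 2 <= a * - b.
  have -> : 4 * m ^+ 2 = (a * - b) * (4 * (a * - b) / (a - b) ^+ 2).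
    by rewrite /m; field; rewrite gt_eqF.
  rewrite ler_piMr ?mulr_ge0 ?oppr_ge0 //; first exact: ltW.
  rewrite ler_pdivrMr ?exprn_gt0 // mul1r.
  have := sqr_ge0 (a + b); rewrite !expr2; lra.
have := sqr_ge0 (2 * m - c); rewrite !expr2; move: m2; rewrite !expr2; lra.
Qed.

(** The term [- g ^+ 2] comes from the growing denominator: passing from [W] to [W + 1] lowers
    [|V|^2 / W] by [|V|^2 / (W (W + 1))], which is at least [g^2] by Cauchy-Schwarz. *)
Lemma potential_step (R : realType) (d : nat) (V x : 'rV[R]_d) (W r g : R) :
  0 < W -> dotp x x <= 1 -> `|r| <= 1 -> g = dotp V x / (W + 1) ->
  dotp (V + r *: x) (V + r *: x) / (W + 1)
    <= dotp V V / W + (2 * (g * r) - g ^+ 2) + W^-1.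
Proof.
move=> W0 x1 r1 gE.
have W1 : 0 < W + 1 by lra.
have cs := dotp_sqr_le V x1.
have r2 : r ^+ 2 <= 1.
  by rewrite -real_normK ?num_real // expr_le1.
have V0 := dotp_ge0 V.
rewrite !(dotpDl, dotpDr, dotpZl, dotpZr) (dotpC x V).
have -> : (dotp V V + r * dotp V x + (r * dotp V x + r * (r * dotp x x))) / (W + 1)
  = dotp V V / W + 2 * (g * r) + r ^+ 2 * dotp x x / (W + 1)
    - dotp V V / (W * (W + 1)).
  by rewrite gE; field; rewrite !gt_eqF.
have h1 : r ^+ 2 * dotp x x / (W + 1) <= W^-1.
  rewrite -[leRHS]mul1r; apply: ler_pM.
  - by rewrite mulr_ge0 ?sqr_ge0 ?dotp_ge0.
  - by rewrite invr_ge0 ltW.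
  - by rewrite mulr_ile1 ?sqr_ge0 ?dotp_ge0.
  - by rewrite lef_pV2 ?posrE //; lra.
have h2 : g ^+ 2 <= dotp V V / (W * (W + 1)).
  rewrite gE expr_div_n; apply: ler_pM; rewrite ?sqr_ge0 ?invr_ge0 ?sqr_ge0 //.
  rewrite lef_pV2 ?posrE ?mulr_gt0 ?exprn_gt0 // expr2 ler_pM2r //; lra.
lra.
Qed.

Lemma slope_le1 (R : realType) (d : nat) (V x : 'rV[R]_d) (W : R) :
  0 < W -> dotp x x <= 1 -> dotp V V <= W ^+ 2 ->
  `|dotp V x / (W + 1)| <= 1.
Proof.
move=> W0 x1 VW; have cs := le_trans (dotp_sqr_le V x1) VW.
rewrite normrM normfV (gtr0_norm (_ : 0 < W + 1)); last lra.
rewrite ler_pdivrMr ?mul1r; last lra.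
apply: (@le_trans _ _ W); last lra.
by rewrite -ler_sqr ?nnegrE ?normr_ge0 ?(ltW W0) // real_normK ?num_real.
Qed.

(** The triangle inequality [|V + r x| <= |V| + 1] in squared form. *)
Lemma dotp_growth (R : realType) (d : nat) (V x : 'rV[R]_d) (W r : R) :
  0 <= W -> dotp x x <= 1 -> `|r| <= 1 -> dotp V V <= W ^+ 2 ->
  dotp (V + r *: x) (V + r *: x) <= (W + 1) ^+ 2.
Proof.
move=> W0 x1 r1 VW.
have r2 : r ^+ 2 <= 1.
  by rewrite -real_normK ?num_real // expr_le1.
have cs : `|dotp V x| <= W.
  rewrite -ler_sqr ?nnegrE ?normr_ge0 // real_normK ?num_real //.
  exact: le_trans (dotp_sqr_le V x1) VW.
have c : r * dotp V x <= W.
  apply: le_trans (ler_norm _) _; rewrite normrM.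
  by apply: le_trans cs; rewrite ler_piMl.
have h : r ^+ 2 * dotp x x <= 1 by rewrite mulr_ile1 ?sqr_ge0 ?dotp_ge0.
rewrite !(dotpDl, dotpDr, dotpZl, dotpZr) (dotpC x V).
have -> : dotp V V + r * dotp V x + (r * dotp V x + r * (r * dotp x x))
   = dotp V V + 2 * (r * dotp V x) + r ^+ 2 * dotp x x by ring.
by rewrite sqrrD expr1n mulr1; lra.
Qed.


(** * The forecaster *)

Definition reg_i : nat := 5.
Definition reg_k : nat := 6.
Definition reg_j : nat := 7.
Definition reg_pow : nat := 8.
Definition reg_log : nat := 9.
Definition arr_sum : nat := 2.
Definition arr_count : nat := 3.
Definition arr_slope : nat := 4.

(* The machine has no logarithm: [reg_log] counts the binary digits of [T]. *)
Definition log_loop : cmd :=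
  CFor reg_i (NReg reg_T)
    (CIf (BLeN (NReg reg_pow) (NReg reg_T))
       (CSeq (CSetN reg_pow (NAdd (NReg reg_pow) (NReg reg_pow)))
             (CSetN reg_log (NAdd (NReg reg_log) (NConst 1))))
       CSkip).

(** The test [m^3 d l <= T] is made on reals because integers cannot be multiplied. Scanning
    upwards, the last success is the largest such [m <= T]; if there is none, [reg_N] keeps its
    default 1. *)
Definition grid_loop : cmd :=
  CFor reg_i (NReg reg_T)
    (CIf (BLeR
           (RMul (RMul (RNat (NAdd (NReg reg_i) (NConst 1)))
                    (RMul (RNat (NAdd (NReg reg_i) (NConst 1)))
                          (RNat (NAdd (NReg reg_i) (NConst 1)))))
              (RMul (RNat (NReg reg_d)) (RNat (NReg reg_log))))
           (RNat (NReg reg_T)))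
       (CSetN reg_N (NAdd (NReg reg_i) (NConst 1)))
       CSkip).

Definition init_prog : cmd :=
  CSeq (CSetN reg_pow (NConst 1))
    (CSeq log_loop (CSeq (CSetN reg_N (NConst 1)) grid_loop)).

Definition dot_loop : cmd :=
  CFor reg_k (NReg reg_d)
    (CSetR arr_slope [:: NReg reg_i]
       (RAdd (RCell arr_slope [:: NReg reg_i])
          (RMul (RCell arr_sum [:: NReg reg_i; NReg reg_k])
                (RCell arr_context [:: NReg reg_k])))).

Definition normalize_slope : cmd :=
  CSetR arr_slope [:: NReg reg_i]
    (RDiv (RCell arr_slope [:: NReg reg_i])
       (RAdd (RAdd (RCell arr_count [:: NReg reg_i])
                   (RDiv (RNat (NReg reg_T)) (RNat (NAdd (NReg reg_N) (NConst 1)))))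
             (RNat (NConst 1)))).

Definition slope_step : cmd :=
  CSeq (CSetR arr_weights [:: NReg reg_i] (RNat (NConst 0)))
    (CSeq (CSetR arr_slope [:: NReg reg_i] (RNat (NConst 0)))
      (CSeq dot_loop normalize_slope)).

Definition slope_loop : cmd :=
  CFor reg_i (NAdd (NReg reg_N) (NConst 1)) slope_step.

Definition slope_at_j : rexp := RCell arr_slope [:: NReg reg_j].

Definition slope_before_j : rexp :=
  RCell arr_slope [:: NSub (NReg reg_j) (NConst 1)].

(** Loops have no early exit; instead [reg_j] advances only past positive slopes, so it freezes at
    the first nonpositive one, or ends at [N]. *)
Definition scan_loop : cmd :=
  CFor reg_i (NReg reg_N)
    (CIf (BLeR slope_at_j (RNat (NConst 0))) CSkip
       (CSetN reg_j (NAdd (NReg reg_j) (NConst 1)))).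

(** At a sign change the two weights are proportional to the opposite slopes, which makes the mean
    slope zero. Without a sign change all mass goes to an endpoint: 0 if the first slope is
    nonpositive, 1 if all slopes are positive. *)
Definition set_weights : cmd :=
  CIf (BAnd (BLeR slope_at_j (RNat (NConst 0)))
            (BLeN (NConst 1) (NReg reg_j)))
    (CSeq (CSetR arr_weights [:: NSub (NReg reg_j) (NConst 1)]
             (RDiv (RSub (RNat (NConst 0)) slope_at_j)
                   (RSub slope_before_j slope_at_j)))
          (CSetR arr_weights [:: NReg reg_j]
             (RDiv slope_before_j (RSub slope_before_j slope_at_j))))
    (CSetR arr_weights [:: NReg reg_j] (RNat (NConst 1))).

Definition predict_prog : cmd :=
  CSeq slope_loop (CSeq (CSetN reg_j (NConst 0)) (CSeq scan_loop set_weights)).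

Definition sum_loop : cmd :=
  CFor reg_k (NReg reg_d)
    (CSetR arr_sum [:: NReg reg_draw; NReg reg_k]
       (RAdd (RCell arr_sum [:: NReg reg_draw; NReg reg_k])
          (RMul (RSub (RNat (NReg reg_outcome))
                      (RDiv (RNat (NReg reg_draw)) (RNat (NReg reg_N))))
                (RCell arr_context [:: NReg reg_k])))).

Definition update_prog : cmd :=
  CSeq sum_loop
    (CSetR arr_count [:: NReg reg_draw]
       (RAdd (RCell arr_count [:: NReg reg_draw]) (RNat (NConst 1)))).

Definition calibrator : forecaster :=
  Forecaster init_prog predict_prog update_prog.


(** * Specifications of the subprograms *)

(** After [k] iterations either [k] doublings have been made or the power already exceeds [T]; as
    [T < 2 ^ T], running [T] iterations is enough. *)
Lemma log_loop_spec (R : realType) (s : state R) :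
  nmem s reg_pow = 1%N -> nmem s reg_log = 0%N ->
  (0 < nmem s reg_T)%N ->
  let l := nmem (exec log_loop s) reg_log in
  (nmem s reg_T < 2 ^ l)%N /\ (2 ^ l <= 2 * nmem s reg_T)%N.
Proof.
move=> p1 l0 T0; set T := nmem s reg_T in T0 *; cbv zeta.
pose P k (s' : state R) := [/\ nmem s' reg_T = T,
  nmem s' reg_pow = (2 ^ nmem s' reg_log)%N, (2 ^ nmem s' reg_log <= 2 * T)%N
  & nmem s' reg_log = k \/ (T < 2 ^ nmem s' reg_log)%N].
have [_ _ h2 h] : P T (exec log_loop s).
  rewrite /log_loop /= -/T; apply: iteri_invariant.
    by split; rewrite ?l0 ?p1 //; [lia|left].
  move=> k s' kT [sT sp sl sk] /=; rewrite sp sT.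
  case: leqP => [h|h] /=; last first.
    by split => //=; right.
  split => //=.
  - by rewrite addnn -mul2n addn1 expnS.
  - by rewrite addn1 expnS leq_mul2l.
  - by rewrite addn1; case: sk => [->|]; [left|lia].
split => //; case: h => // ->; exact: ltn_expl.
Qed.

Lemma grid_loop_spec (R : realType) (s : state R) :
  let T := nmem s reg_T in
  let D := (nmem s reg_d * nmem s reg_log)%N in
  let N := nmem (exec grid_loop s) reg_N in
  nmem s reg_N = 1%N ->
  [/\ (0 < N)%N, N = 1%N \/ (N <= T)%N /\ (N ^ 3 * D <= T)%N
    & forall m, (0 < m <= T)%N -> (m ^ 3 * D <= T)%N -> (m <= N)%N].
Proof.
move=> T D N N1.
pose P k (s' : state R) := [/\ nmem s' reg_T = T,
  (nmem s' reg_d * nmem s' reg_log)%N = D,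
  (0 < nmem s' reg_N)%N,
  nmem s' reg_N = 1%N \/ (nmem s' reg_N <= k)%N /\ (nmem s' reg_N ^ 3 * D <= T)%N &
  forall m, (0 < m <= k)%N -> (m ^ 3 * D <= T)%N -> (m <= nmem s' reg_N)%N].
have [_ _ h1 h2 h3] : P T (exec grid_loop s); last by split.
rewrite /grid_loop /= -/T; apply: iteri_invariant.
  split => //; rewrite ?N1 //; first by left.
  by move=> m; lia.
move=> k s' kT [sT sD sN sk sm] /=.
rewrite -!natrM ler_nat sT.
have -> : ((k + 1) * ((k + 1) * (k + 1)) * (nmem s' reg_d * nmem s' reg_log)
   = k.+1 ^ 3 * D)%N by rewrite sD !addn1 !expnS expn0 muln1.
case: leqP => [h|h]; split => //=; rewrite ?addn1 //.
- by right.
- by move=> m /andP[].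
- by case: sk => [|[sk1 sk2]]; [left|right; split => //; apply: leqW].
- move=> m /andP[m0]; rewrite leq_eqVlt => /orP[/eqP ->|]; first by lia.
  by move=> mk; apply: sm; rewrite m0.
Qed.

Lemma init_arr (R : realType) (T d : nat) (a : nat) (ix : seq nat) :
  rmem (initial_state R calibrator T d) a ix = 0.
Proof. by rewrite /initial_state exec_arr. Qed.

Lemma init_reg_T (R : realType) (T d : nat) :
  nmem (initial_state R calibrator T d) reg_T = T.
Proof. by rewrite /initial_state exec_reg. Qed.

Lemma init_reg_d (R : realType) (T d : nat) :
  nmem (initial_state R calibrator T d) reg_d = d.
Proof. by rewrite /initial_state exec_reg. Qed.

Lemma grid_size_spec (R : realType) (T d : nat) : (0 < T)%N -> (0 < d)%N ->
  let N := grid_size R calibrator T d in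
  exists l, [/\ (0 < N <= T)%N, (T < 2 ^ l <= 2 * T)%N,
    N = 1%N \/ (N ^ 3 * (d * l) <= T)%N & (T < N.+1 ^ 3 * (d * l))%N].
Proof.
move=> T0 d0 N.
pose s0 : state R := set_nat (start_state R T d) reg_pow 1.
pose s1 := exec log_loop s0.
pose s2 := set_nat s1 reg_N 1.
have [l1 l2] := @log_loop_spec R s0 erefl erefl T0.
have := @grid_loop_spec R s2 erefl.
have -> : exec grid_loop s2 = initial_state R calibrator T d by [].
have -> : nmem s2 reg_T = T by rewrite /s2 /= exec_reg.
have -> : nmem s2 reg_d = d by rewrite /s2 /= exec_reg.
have -> : nmem s2 reg_log = nmem s1 reg_log by [].
move: l1 l2; rewrite -/s1 [nmem s0 reg_T]/=.
set l := nmem s1 reg_log => l1 l2; rewrite -/(grid_size R calibrator T d) -/N.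
move=> [N0 N1 Nm]; exists l; split; rewrite ?l1 ?N0 //.
- by case: N1 => [->|[]].
- by case: N1 => [|[]]; [left|right].
- have l0 : (0 < l)%N by move: l1; case: (l) => //; lia.
  have dl0 : (0 < d * l)%N by rewrite muln_gt0 d0.
  rewrite ltnNge; apply/negP => h.
  (* Maximality of [N] only speaks of values up to [T]. If [N] reaches [T], the cube of [N + 1]
     exceeds [T] by itself. *)
  have NT : (T <= N)%N.
    rewrite leqNgt; apply/negP => NT.
    by have := Nm N.+1; rewrite NT h ltnn => /(_ isT isT).
  move: h; apply/negP; rewrite -ltnNge.
  apply: (@leq_trans (N.+1 ^ 3)); last exact: leq_pmulr.
  by apply: (@leq_trans (N.+1 ^ 1)); [rewrite !expn1 ltnS|rewrite leq_pexp2l].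
Qed.

Lemma dot_loop_spec (R : realType) (s : state R) :
  rmem (exec dot_loop s) arr_slope [:: nmem s reg_i] =
    rmem s arr_slope [:: nmem s reg_i] +
    \sum_(k < nmem s reg_d)
      rmem s arr_sum [:: nmem s reg_i; val k] * rmem s arr_context [:: val k]
  /\ forall ix, ix != [:: nmem s reg_i] ->
     rmem (exec dot_loop s) arr_slope ix = rmem s arr_slope ix.
Proof.
set i := nmem s reg_i.
pose P m (s' : state R) := [/\ nmem s' reg_i = i,
  rmem s' arr_sum = rmem s arr_sum, rmem s' arr_context = rmem s arr_context,
  rmem s' arr_slope [:: i] = rmem s arr_slope [:: i] +
    \sum_(k < m) rmem s arr_sum [:: i; val k] * rmem s arr_context [:: val k]
  & forall ix, ix != [:: i] -> rmem s' arr_slope ix = rmem s arr_slope ix].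
suff [] : P (nmem s reg_d) (exec dot_loop s) by [].
rewrite /dot_loop /=; apply: iteri_invariant.
  by split => //; rewrite big_ord0 addr0.
move=> k s' _ [h1 h2 h3 h4 h5]; split => //=.
- by rewrite !h1 eqxx big_ord_recr /= h4 h2 h3 addrA.
- by move=> ix ixi; rewrite h1 (negbTE ixi) h5.
Qed.

Definition slope_of (R : realType) (s : state R) (i : nat) : R :=
  (\sum_(k < nmem s reg_d)
     rmem s arr_sum [:: i; val k] * rmem s arr_context [:: val k])
  / (rmem s arr_count [:: i] + (nmem s reg_T)%:R / (nmem s reg_N).+1%:R + 1).

Lemma slope_loop_spec (R : realType) (s : state R) (i : nat) :
  (i <= nmem s reg_N)%N ->
  rmem (exec slope_loop s) arr_slope [:: i] = slope_of s i /\
  rmem (exec slope_loop s) arr_weights [:: i] = 0.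
Proof.
move=> iN.
pose P m (s' : state R) := [/\ forall r, r \in [:: reg_T; reg_d; reg_N] ->
    nmem s' r = nmem s r,
  forall a, a \in [:: arr_sum; arr_context; arr_count] -> rmem s' a = rmem s a
  & forall i, (i < m)%N -> rmem s' arr_slope [:: i] = slope_of s i /\
      rmem s' arr_weights [:: i] = 0].
suff [_ _ h] : P (nmem s reg_N).+1 (exec slope_loop s) by apply: h.
have -> : exec slope_loop s =
    iteri (nmem s reg_N).+1 (fun m s' => exec slope_step (set_nat s' reg_i m)) s.
  by rewrite -(addn1 (nmem s reg_N)).
apply: iteri_invariant; first by split.
move=> m s' mN [h1 h2 h3].
pose s1 := set_nat s' reg_i m.
pose s2 := set_real s1 arr_weights [:: m] 0.
pose s3 := set_real s2 arr_slope [:: m] 0.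
pose s4 := exec dot_loop s3.
have [d1 d2] := dot_loop_spec s3; rewrite -/s4 in d1 d2.
have -> : exec slope_step (set_nat s' reg_i m) = exec normalize_slope s4 by [].
have dr r : r \in [:: reg_T; reg_d; reg_N; reg_i] ->
    nmem s4 r = nmem s1 r.
  move=> rr; rewrite exec_reg; first by [].
  by move: rr; rewrite !inE => /or4P[]/eqP->.
have da a : a \in [:: arr_sum; arr_context; arr_count] ->
    rmem s4 a = rmem s a.
  move=> aa; rewrite exec_arr.
    by rewrite -h2 //; move: aa; rewrite !inE => /or3P[]/eqP->.
  by move: aa; rewrite !inE => /or3P[]/eqP->.
split.
- move=> r rr; rewrite [LHS]/=.
  rewrite dr ?inE; last by move: rr; rewrite !inE => /or3P[]->; rewrite ?orbT.
  rewrite -h1 //=.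
  by move: rr; rewrite !inE => /or3P[]/eqP->.
- move=> a aa; rewrite -(da a aa) /=.
  by apply/funext => ix; move: aa; rewrite !inE => /or3P[]/eqP->.
- have si : nmem s4 reg_i = m by rewrite dr.
  have s3i : nmem s3 reg_i = m by [].
  move=> j; rewrite ltnS leq_eqVlt => /orP[/eqP->|jm].
  + split.
      rewrite [LHS]/= si !eqxx /= !dr // (da arr_count) //.
      move: d1; rewrite s3i => ->.
      rewrite [rmem s3 _ _]/= !eqxx /= add0r /slope_of.
      congr (_ / _); last first.
        by rewrite -(h1 reg_T) // -(h1 reg_N) // addn1.
      rewrite (h1 reg_d) //; apply: eq_bigr => k _.
      by rewrite -(h2 arr_sum) // -(h2 arr_context).
    by rewrite [LHS]/= /s4 exec_arr //= !eqxx.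
  + have jm' : ([:: j] == [:: m]) = false.
      by apply/negP => /eqP[] E; rewrite E ltnn in jm.
    have [g1 g2] := h3 j jm.
    rewrite [rmem _ arr_slope _]/= [rmem _ arr_weights _]/= si jm' /=.
    rewrite d2 ?s3i ?jm' // /s4 exec_arr //= jm' /=; split; first by rewrite -g1.
    by rewrite -g2.
Qed.

Lemma scan_loop_spec (R : realType) (s : state R) :
  nmem s reg_j = 0%N ->
  let g i := rmem s arr_slope [:: i] in
  let j := nmem (exec scan_loop s) reg_j in
  [/\ (j <= nmem s reg_N)%N, (0 < j)%N -> 0 < g j.-1 &
      j = nmem s reg_N \/ g j <= 0].
Proof.
move=> j0 g j.
pose P m (s' : state R) := [/\ rmem s' arr_slope = rmem s arr_slope,
  (nmem s' reg_j <= m)%N, (0 < nmem s' reg_j)%N -> 0 < g (nmem s' reg_j).-1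
  & nmem s' reg_j = m \/ g (nmem s' reg_j) <= 0].
suff [] : P (nmem s reg_N) (exec scan_loop s) by [].
rewrite /scan_loop /=; apply: iteri_invariant; first by split; rewrite ?j0 //; left.
move=> m s' mN [h1 h2 h3 h4] /=; rewrite h1 -/(g _).
case: leP => h; split => //=; rewrite ?addn1 //.
- exact: leqW.
- by right.
- by case: h4 => [->|]; [left|rewrite leNgt h].
Qed.

Lemma predict_spec (R : realType) (s : state R) :
  let N := nmem s reg_N in
  let g := slope_of s in
  exists j, [/\ (j <= N)%N, (0 < j)%N -> 0 < g j.-1, j = N \/ g j <= 0 &
    forall i, (i <= N)%N -> rmem (exec predict_prog s) arr_weights [:: i] =
      if (g j <= 0) && (0 < j)%N then
        if i == j then g j.-1 / (g j.-1 - g j)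
        else if i == j.-1 then - g j / (g j.-1 - g j) else 0
      else (i == j)%:R].
Proof.
move=> N g.
pose s1 := set_nat (exec slope_loop s) reg_j 0.
have s1N : nmem s1 reg_N = N by exact: (@exec_reg _ reg_N slope_loop s).
have [] := @scan_loop_spec R s1 erefl; rewrite s1N.
set s2 := exec scan_loop s1; set j := nmem s2 reg_j => jN.
have gi i : (i <= N)%N -> rmem s1 arr_slope [:: i] = g i.
  by move=> /slope_loop_spec[].
rewrite !gi ?(leq_trans (leq_pred _)) // => h1 h2; exists j; split => // i iN.
have wi : rmem s2 arr_weights [:: i] = 0.
  have -> : rmem s2 arr_weights = rmem s1 arr_weights by exact: exec_arr.
  by case: (slope_loop_spec iN).
have g2 k : (k <= N)%N -> rmem s2 arr_slope [:: k] = g k.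
  have -> : rmem s2 arr_slope = rmem s1 arr_slope by exact: exec_arr.
  exact: gi.
rewrite -[exec predict_prog s]/(exec set_weights s2) -/s2 /=.
have jN' : (j - 1 <= N)%N by lia.
have gj1 := g2 _ jN'; have gj := g2 _ jN; rewrite /j in gj gj1.
rewrite gj ?gj1 -/j; case: (boolP ((g j <= 0) && (0 < j)%N)) => _ /=; last first.
  by rewrite eqseq_cons andbT; case: eqP => //= _; rewrite wi.
rewrite -/j !eqseq_cons !andbT sub0r subn1.
by case: ifP => // _; case: ifP.
Qed.

Lemma sum_loop_spec (R : realType) (s : state R) (i k : nat) :
  (k < nmem s reg_d)%N ->
  rmem (exec sum_loop s) arr_sum [:: i; k] =
    rmem s arr_sum [:: i; k] + (i == nmem s reg_draw)%:R *
      (((nmem s reg_outcome)%:R - (nmem s reg_draw)%:R / (nmem s reg_N)%:R)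
         * rmem s arr_context [:: k]).
Proof.
move=> kd; set c := _ - _.
pose P m (s' : state R) := [/\
  [/\ nmem s' reg_draw = nmem s reg_draw, nmem s' reg_outcome = nmem s reg_outcome
   & nmem s' reg_N = nmem s reg_N], rmem s' arr_context = rmem s arr_context
  & forall i k, rmem s' arr_sum [:: i; k] = rmem s arr_sum [:: i; k] +
      ((i == nmem s reg_draw) && (k < m)%N)%:R * (c * rmem s arr_context [:: k])].
suff [_ _ ->] : P (nmem s reg_d) (exec sum_loop s) by rewrite kd andbT.
rewrite /sum_loop /=; apply: iteri_invariant.
  by split => // i' k'; rewrite ltn0 andbF mul0r addr0.
move=> m s' _ [[h1 h2 h3] h4 h5] /=; split => //= i' k'.
rewrite !eqseq_cons andbT h1 h2 h3 h4 h5 ltnS.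
case: (eqVneq i' (nmem s reg_draw)) => [->|ne] /=; last first.
  by rewrite h5 (negbTE ne).
rewrite h5 eqxx /=; case: (ltngtP k' m) => [||->]; rewrite ?mul0r ?addr0 //.
by rewrite ltnn mul0r addr0 mul1r.
Qed.

Lemma update_spec (R : realType) (s : state R) (i : nat) :
  (forall k, (k < nmem s reg_d)%N ->
    rmem (exec update_prog s) arr_sum [:: i; k] =
    rmem s arr_sum [:: i; k] + (i == nmem s reg_draw)%:R *
      (((nmem s reg_outcome)%:R - (nmem s reg_draw)%:R / (nmem s reg_N)%:R)
         * rmem s arr_context [:: k])) /\
  rmem (exec update_prog s) arr_count [:: i] =
    rmem s arr_count [:: i] + (i == nmem s reg_draw)%:R.
Proof.
split => [k kd|]; first by rewrite -sum_loop_spec.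
pose s1 := exec sum_loop s.
have -> : rmem (exec update_prog s) arr_count [:: i] =
    if [:: i] == [:: nmem s1 reg_draw]
    then rmem s1 arr_count [:: nmem s1 reg_draw] + 1 else rmem s1 arr_count [:: i].
  by [].
have -> : nmem s1 reg_draw = nmem s reg_draw by exact: exec_reg.
have -> : rmem s1 arr_count = rmem s arr_count by exact: exec_arr.
rewrite eqseq_cons andbT.
by case: eqP => [->|_] //=; rewrite addr0.
Qed.


(** * The machine state as a function of the history *)

Section Run.
Variables (R : realType) (T d : nat).
Implicit Types (h : seq ('rV[R]_d * bool * nat)) (s : state R) (x : 'rV[R]_d).

Definition run h : state R :=
  foldl (@after_round R calibrator d) (initial_state R calibrator T d) h.

Lemma load_context_arr x s a : a != arr_context ->
  rmem (load_context x s) a = rmem s a.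
Proof.
move=> a0; apply/funext => -[//|j [|//]]; rewrite [LHS]/=.
by case: ifP => // a1; move: a0; rewrite (eqP a1).
Qed.

Lemma load_context_coord x s (k : 'I_d) :
  rmem (load_context x s) arr_context [:: val k] = x 0 k.
Proof. by rewrite /= insubT //= => kd; congr (x 0 _); apply: val_inj. Qed.

Lemma after_predict_reg s x r : r \in [:: reg_T; reg_d; reg_N] ->
  nmem (after_predict calibrator s x) r = nmem s r.
Proof.
move=> rr; rewrite exec_reg //.
by move: rr; rewrite !inE => /or3P[]/eqP->.
Qed.

Lemma after_round_reg s (e : 'rV[R]_d * bool * nat) r :
  r \in [:: reg_T; reg_d; reg_N] ->
  nmem (after_round calibrator s e) r = nmem s r.
Proof.
move=> rr; rewrite exec_reg; last by move: rr; rewrite !inE => /or3P[]/eqP->.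
rewrite -(after_predict_reg s e.1.1 rr).
by move: rr; rewrite !inE => /or3P[]/eqP->.
Qed.

Lemma run_reg h r : r \in [:: reg_T; reg_d; reg_N] ->
  nmem (run h) r = nmem (initial_state R calibrator T d) r.
Proof.
move=> rr; rewrite /run; elim/last_ind: h => [//|h e IH].
by rewrite foldl_rcons after_round_reg.
Qed.

Lemma run_N h : nmem (run h) reg_N = grid_size R calibrator T d.
Proof. exact: run_reg. Qed.

Lemma run_T h : nmem (run h) reg_T = T.
Proof. by rewrite run_reg // init_reg_T. Qed.

Lemma run_d h : nmem (run h) reg_d = d.
Proof. by rewrite run_reg // init_reg_d. Qed.

Let N := grid_size R calibrator T d.

Definition residual (i : nat) (e : 'rV[R]_d * bool * nat) : 'rV[R]_d :=
  (e.1.2%:R - i%:R / N%:R) *: e.1.1.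

(** The vector [V_i] of the potential; [hits] below is the count [n_i] and [slope] is [g_i]. *)
Definition bias h (i : nat) : 'rV[R]_d :=
  \sum_(e <- h | e.2 == i) residual i e.

Definition hits h (i : nat) : nat := count (fun e => e.2 == i) h.

Lemma bias_rcons h e i : bias (rcons h e) i =
  bias h i + (if e.2 == i then residual i e else 0).
Proof.
by rewrite /bias -cats1 big_cat big_cons big_nil /=; case: ifP => _; rewrite ?addr0.
Qed.

Lemma hits_rcons h e i : hits (rcons h e) i = (hits h i + (e.2 == i))%N.
Proof. by rewrite /hits -cats1 count_cat /= addn0. Qed.

Lemma run_rcons h e : run (rcons h e) =
  exec update_prog (load_feedback e.2 e.1.2 (after_predict calibrator (run h) e.1.1)).
Proof. by rewrite /run foldl_rcons. Qed.

Lemma feedback_arr s x i y a : a \in [:: arr_sum; arr_count] ->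
  rmem (load_feedback i y (after_predict calibrator s x)) a = rmem s a.
Proof.
move=> aa; rewrite -(@load_context_arr x s); last first.
  by move: aa; rewrite !inE => /orP[]/eqP->.
apply: (@exec_arr _ a predict_prog).
by move: aa; rewrite !inE => /orP[]/eqP->.
Qed.

Lemma feedback_context s x i y :
  rmem (load_feedback i y (after_predict calibrator s x)) arr_context =
  rmem (load_context x s) arr_context.
Proof. exact: (@exec_arr _ arr_context predict_prog). Qed.

Lemma run_sum h i (k : 'I_d) : rmem (run h) arr_sum [:: i; val k] = bias h i 0 k.
Proof.
elim/last_ind: h => [|h e IH]; first by rewrite init_arr /bias big_nil mxE.
rewrite run_rcons; set s := load_feedback _ _ _.
have sN : nmem s reg_N = N 
  by apply: etrans (run_N h); apply: (@after_predict_reg (run h) e.1.1 reg_N).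
have sd : nmem s reg_d = d 
  by apply: etrans (run_d h); apply: (@after_predict_reg (run h) e.1.1 reg_d).
have [upd _] := update_spec s i; rewrite upd; last by rewrite sd; apply: ltn_ord.
rewrite sN /s feedback_arr // feedback_context load_context_coord IH.
rewrite bias_rcons mxE; congr (_ + _).
rewrite -/s [nmem s reg_draw]/= [nmem s reg_outcome]/= eq_sym.
case: eqP => [<-|_]; last by rewrite mul0r mxE.
by rewrite mul1r mxE.
Qed.

Lemma run_count h i : rmem (run h) arr_count [:: i] = (hits h i)%:R.
Proof.
elim/last_ind: h => [|h e IH]; first by rewrite init_arr.
rewrite run_rcons; set s := load_feedback _ _ _.
have [_ ->] := update_spec s i.
rewrite /s feedback_arr // IH hits_rcons natrD [nmem _ _]/= eq_sym //.
Qed.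

Definition slope h x (i : nat) : R :=
  dotp (bias h i) x / ((hits h i)%:R + T%:R / N.+1%:R + 1).

Lemma slope_of_run h x i : slope_of (load_context x (run h)) i = slope h x i.
Proof.
rewrite /slope_of [nmem _ reg_T]run_T [nmem _ reg_N]run_N.
rewrite [nmem _ reg_d]run_d.
rewrite (@load_context_arr x (run h) arr_count) // run_count.
rewrite (@load_context_arr x (run h) arr_sum) //.
congr (_ / _); apply: eq_bigr => k _.
by rewrite load_context_coord run_sum.
Qed.

(** The weights expressed through the history alone; the probabilistic analysis reaches the
    prediction program only through this statement. *)
Lemma run_weights h x : exists j, [/\ (j <= N)%N,
   (0 < j)%N -> 0 < slope h x j.-1, j = N \/ slope h x j <= 0 &
    forall i, (i <= N)%N ->
      rmem (after_predict calibrator (run h) x) arr_weights [:: i] =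
      if (slope h x j <= 0) && (0 < j)%N then
        if i == j then slope h x j.-1 / (slope h x j.-1 - slope h x j)
        else if i == j.-1 then - slope h x j / (slope h x j.-1 - slope h x j) else 0
      else (i == j)%:R].
Proof.
have [j []] := predict_spec (load_context x (run h)).
rewrite [nmem _ _]run_N !slope_of_run => ? ? ? ?.
by exists j; split.
Qed.

End Run.

(** * Polynomial running time *)

Lemma calibrator_efficient (R : realType) : efficient R calibrator.
Proof.
pose c := (cost_scale init_prog + cost_scale predict_prog + cost_scale update_prog + 3)%N.
pose k := (cost_depth init_prog + cost_depth predict_prog + cost_depth update_prog + 2)%N.
exists c, k => T d T2 d1 e p _.
pose M := (T + d)%N.
have M0 : (0 < M)%N by rewrite /M; lia.
have MM a b : (a <= b)%N -> (M ^ a <= M ^ b)%N by move=> ?; rewrite leq_pexp2l.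
have [l [/andP[N0 NT] _ _ _]] := grid_size_spec R (ltnW T2) d1.
(* The extra 1 in the exponent gives [M <= M ^ K], which pays for reading the context and for
   sampling, as [N.+1 <= M]. The sum over rounds then costs one more factor [M]. *)
pose K := (cost_depth init_prog + cost_depth predict_prog + cost_depth update_prog + 1)%N.
have ci : (cost init_prog (start_state R T d) <= cost_scale init_prog * M ^ K)%N.
  apply: (@leq_trans (cost_scale init_prog * M ^ cost_depth init_prog)); last first.
    by rewrite leq_mul2l MM ?orbT // /K; lia.
  apply: (@cost_le _ [:: reg_T]) => // r; rewrite inE => /eqP ->.
  exact: leq_addr.
have regs (s : state R) : nmem s reg_T = T -> nmem s reg_d = d ->
    nmem s reg_N = grid_size R calibrator T d ->
    forall r, r \in [:: reg_T; reg_d; reg_N] -> (nmem s r <= M)%N.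
  move=> sT sd sN r; rewrite !inE => /or3P[]/eqP->; rewrite ?sT ?sd ?sN /M; lia.
have round t : (d + cost predict_prog (load_context (tnth e t).1
        (state_before calibrator e p t)) + (grid_size R calibrator T d).+1
      + cost update_prog (load_feedback (tnth p t) (tnth e t).2
          (after_predict calibrator (state_before calibrator e p t) (tnth e t).1))
    <= (cost_scale predict_prog + cost_scale update_prog + 3) * M ^ K)%N.
  set s := state_before _ _ _ _.
  have sT : nmem s reg_T = T by exact: run_T.
  have sd : nmem s reg_d = d by exact: run_d.
  have sN : nmem s reg_N = grid_size R calibrator T d by exact: run_N.
  have h1 : (cost predict_prog (load_context (tnth e t).1 s)
      <= cost_scale predict_prog * M ^ K)%N.
    apply: (@leq_trans (cost_scale predict_prog * M ^ cost_depth predict_prog)); last first.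
      by rewrite leq_mul2l MM ?orbT // /K; lia.
    by apply: (@cost_le _ [:: reg_T; reg_d; reg_N]) => //; apply: regs.
  have h2 : (cost update_prog (load_feedback (tnth p t) (tnth e t).2
          (after_predict calibrator s (tnth e t).1)) <= cost_scale update_prog * M ^ K)%N.
    apply: (@leq_trans (cost_scale update_prog * M ^ cost_depth update_prog)); last first.
      by rewrite leq_mul2l MM ?orbT // /K; lia.
    apply: (@cost_le _ [:: reg_T; reg_d; reg_N]) => //; apply: regs.
    - by apply: etrans sT; apply: (@after_predict_reg _ _ s (tnth e t).1 reg_T).
    - by apply: etrans sd; apply: (@after_predict_reg _ _ s (tnth e t).1 reg_d).
    - by apply: etrans sN; apply: (@after_predict_reg _ _ s (tnth e t).1 reg_N).
  have h3 : (M <= M ^ K)%N.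
    by rewrite -[X in (X <= _)%N]expn1 MM // /K; lia.
  rewrite !mulnDl; apply: leq_trans (leq_add (leq_add (leq_add (leqnn d) h1)
    (_ : _ <= M)%N) h2) _; first by rewrite /M; lia.
  have : (d <= M)%N by rewrite /M; lia.
  lia.
rewrite /running_time.
apply: (@leq_trans (cost_scale init_prog * M ^ K +
  \sum_(t < T) (cost_scale predict_prog + cost_scale update_prog + 3) * M ^ K)%N).
  by apply: leq_add => //; apply: leq_sum => t _; apply: round.
rewrite sum_nat_const card_ord.
have -> : k = K.+1 by rewrite /k /K; lia.
rewrite -/M expnS.
set X := (cost_scale predict_prog + cost_scale update_prog + 3)%N.
have -> : c = (cost_scale init_prog + X)%N by rewrite /c /X; lia.
rewrite mulnDl; apply: leq_add; first by rewrite leq_mul2l leq_pmull ?orbT.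
by rewrite mulnCA leq_mul2l leq_mul2r /M leq_addr !orbT.
Qed.


(** * Exponential moments of the potential *)

Lemma sum_tuple_cons (R : nmodType) (I : finType) (n : nat)
    (F : n.+1.-tuple I -> R) :
  \sum_p F p = \sum_i \sum_(q : n.-tuple I) F [tuple of i :: q].
Proof.
rewrite pair_big /=.
rewrite (reindex (fun x : I * n.-tuple I => [tuple of x.1 :: x.2])) //=.
exists (fun p : n.+1.-tuple I => (thead p, [tuple of behead p])).
  by move=> [i q] _ /=; congr pair; apply: val_inj.
by move=> p _; rewrite [RHS]tuple_eta.
Qed.

(** The supermartingale bound, with finite sums in place of conditional expectations. The induction
    peels off the first draw, after which the shifted weights and [G] satisfy the same hypotheses.
    [G] may be negative, as in [draw_prob_sum]. *)
Lemma sequential_draws_le (R : realType) (I : finType) (n : nat)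
    (w : seq I -> I -> R) (G : seq I -> R) (rho : R) :
  0 <= rho -> (forall s i, (size s < n)%N -> 0 <= w s i) ->
  (forall s, (size s < n)%N -> \sum_i w s i * G (rcons s i) <= rho * G s) ->
  \sum_(p : n.-tuple I) (\prod_(t < n) w (take t p) (tnth p t)) * G p
    <= rho ^+ n * G [::].
Proof.
move=> rho0; elim: n w G => [|n IH] w G w0 wG.
  rewrite expr0 mul1r (big_pred1 [tuple]) ?big_ord0 ?mul1r //.
  by move=> p; apply/esym/eqP; apply: tuple0.
rewrite sum_tuple_cons.
apply: (@le_trans _ _ (\sum_i w [::] i * (rho ^+ n * G [:: i]))); last first.
  rewrite exprSr -mulrA.
  under eq_bigr do rewrite mulrCA.
  by rewrite -mulr_sumr ler_wpM2l ?exprn_ge0 //; apply: wG.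
apply: ler_sum => i _.
have : \sum_(q : n.-tuple I)
    (\prod_(t < n) w (i :: take t q) (tnth q t)) * G (i :: q)
    <= rho ^+ n * G [:: i].
  apply: (IH (fun s => w (i :: s)) (fun s => G (i :: s))) => s *.
    exact: w0.
  exact: wG.
move=> /(ler_wpM2l (w0 [::] i isT)); apply: le_trans.
rewrite mulr_sumr le_eqVlt; apply/orP; left; apply/eqP.
apply: eq_bigr => q _; rewrite big_ord_recl -!mulrA; congr (_ * (_ * _)).
by apply: eq_bigr => t _; rewrite tnthS.
Qed.

Lemma zip_take (S U : Type) (s : seq S) (t : seq U) (k : nat) :
  zip s (take k t) = take k (zip s t).
Proof. by elim: s t k => [|x s IH] [|y t] [|k] //=; rewrite IH. Qed.

Lemma zip_rcons_nth (S U : Type) (x0 : S) (s : seq S) (t : seq U) (y : U) :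
  (size t < size s)%N ->
  zip s (rcons t y) = rcons (zip s t) (nth x0 s (size t), y).
Proof.
elim: s t => [|x s IH] [|z t] //= h; first by case: (s).
by rewrite IH.
Qed.

(** * The potential along a run *)

Section Potential.
Variables (R : realType) (T d : nat).
Let N := grid_size R calibrator T d.
Hypotheses (T0 : (0 < T)%N) (N0 : (0 < N)%N).
Implicit Types (h : seq ('rV[R]_d * bool * nat)) (x : 'rV[R]_d) (y : bool).

(** Chosen so that the shifts of the [N + 1] counts add up to [T], while the increments [1 / K] over
    [T] rounds add up to only [N + 1]. *)
Let K : R := T%:R / N.+1%:R.

Let K0 : 0 < K.
Proof. by rewrite divr_gt0 ?ltr0n. Qed.

Let NR0 : 0 < N%:R :> R.
Proof. by rewrite ltr0n. Qed.

Definition weight h x (i : nat) : R :=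
  rmem (after_predict calibrator (run T h) x) arr_weights [:: i].

Lemma deviation_le1 y (i : 'I_N.+1) : `|y%:R - (val i)%:R / N%:R : R| <= 1.
Proof.
have : (val i)%:R / N%:R <= 1 :> R.
  by rewrite ler_pdivrMr // mul1r ler_nat -ltnS ltn_ord.
have : 0 <= (val i)%:R / N%:R :> R by rewrite divr_ge0.
by rewrite ler_norml; case: y => /= h1 h2; apply/andP; split; lra.
Qed.

(** The drift bound holds for both outcomes [y], as it must: the weights are fixed before the
    outcome is revealed. *)
Lemma weight_spec h x y :
  [/\ forall i : 'I_N.+1, 0 <= weight h x i, \sum_(i < N.+1) weight h x i = 1 &
   \sum_(i < N.+1) weight h x i * (slope T h x i * (y%:R - i%:R / N%:R))
     <= (\sum_(i < N.+1) weight h x i * slope T h x i ^+ 2 + N%:R ^- 2) / 4].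
Proof.
have [j [jN gj1 gj wE]] := run_weights T h x.
rewrite -/N in jN gj wE.
set g := slope T h x in gj1 gj wE *.
pose jo := Ordinal (jN : (j < N.+1)%N).
case: (boolP ((g j <= 0) && (0 < j)%N)) wE => [/andP[gj0 j0]|gj0] wE.
- have kN : (j.-1 < N.+1)%N by lia.
  pose ko := Ordinal kN.
  have ag := gj1 j0.
  have ab : 0 < g j.-1 - g j by lra.
  have two (F : 'I_N.+1 -> R) : \sum_(i < N.+1) weight h x i * F i =
      (- g j / (g j.-1 - g j)) * F ko + (g j.-1 / (g j.-1 - g j)) * F jo.
    rewrite (bigD1 jo) //= (bigD1 ko) /=; last first.
      by apply/eqP => /(congr1 val) /=; lia.
    rewrite big1 ?addr0; last first.
      move=> i /andP[ij ik]; rewrite /weight wE; last by rewrite -ltnS.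
      rewrite -!(inj_eq val_inj) /= in ij ik.
      by rewrite (negbTE ij) (negbTE ik) mul0r.
    rewrite addrC; congr (_ * _ + _ * _); rewrite /weight wE ?leq_pred //= ?eqxx //.
      by case: eqP => //; lia.
  split.
  + move=> i; rewrite /weight wE; last by rewrite -ltnS.
    case: ifP => _; first by rewrite divr_ge0 ?ltW.
    by case: ifP => // _; rewrite divr_ge0 ?oppr_ge0 // ltW.
  + under eq_bigr do rewrite -[weight _ _ _]mulr1.
    by rewrite two !mulr1 -mulrDl addrC divff // gt_eqF.
  + rewrite two (two (fun i => g i ^+ 2)).
    apply: crossing_drift => //=.
    by rewrite -{1}(prednK j0) -natr1 mulrDl.
- have one (F : 'I_N.+1 -> R) : \sum_(i < N.+1) weight h x i * F i = F jo.
    rewrite (bigD1 jo) //= big1 ?addr0; last first.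
      move=> i ij; rewrite /weight wE; last by rewrite -ltnS.
      by rewrite -(inj_eq val_inj) /= in ij; rewrite (negbTE ij) mul0r.
    by rewrite /weight wE // eqxx mul1r.
  split.
  + by move=> i; rewrite /weight wE ?ler0n // -ltnS.
  + by under eq_bigr do rewrite -[weight _ _ _]mulr1; rewrite one.
  + rewrite one (one (fun i => g i ^+ 2)) /=.
    (* At an endpoint the drift is nonpositive: at 0 the slope is nonpositive and [y - 0 >= 0], at 1
       the slope is positive and [y - 1 <= 0]. *)
    apply: (@le_trans _ _ 0); last first.
      by rewrite divr_ge0 // addr_ge0 ?sqr_ge0 // invr_ge0 sqr_ge0.
    have [gle|ggt] := lerP (g j) 0.
      have -> : j%:R = 0 :> R by move: gj0; rewrite gle /= lt0n negbK => /eqP->.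
      by rewrite mul0r subr0 mulr_le0_ge0.
    have -> : j%:R = N%:R :> R.
      by case: gj => [->//|]; rewrite leNgt ggt.
    rewrite divff ?gt_eqF // mulr_ge0_le0 ?(ltW ggt) //.
    by case: (y) => /=; lra.
Qed.

Definition unit_contexts h : Prop := forall e, e \in h -> dotp e.1.1 e.1.1 <= 1.

Lemma bias_le_hits h (i : 'I_N.+1) : unit_contexts h ->
  dotp (bias T h i) (bias T h i) <= (hits h i)%:R ^+ 2.
Proof.
elim/last_ind: h => [|h e IH] he.
  by rewrite /bias big_nil dotp0l sqr_ge0.
rewrite bias_rcons hits_rcons; case: eqP => [ei|_]; last first.
  by rewrite addr0 addn0; apply: IH => e' eh; apply: he; rewrite mem_rcons inE eh orbT.
rewrite natrD; apply: dotp_growth => //.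
- by apply: he; rewrite mem_rcons inE eqxx.
- exact: deviation_le1.
- by apply: IH => e' eh; apply: he; rewrite mem_rcons inE eh orbT.
Qed.

Definition energy h (i : nat) : R :=
  dotp (bias T h i) (bias T h i) / ((hits h i)%:R + K).

Definition potential h : R := \sum_(i < N.+1) energy h i.

Lemma potential_rcons h x y (i : 'I_N.+1) : dotp x x <= 1 ->
  potential (rcons h ((x, y), val i)) <=
  potential h + (2 * (slope T h x i * (y%:R - (val i)%:R / N%:R))
                 - slope T h x i ^+ 2) + K^-1.
Proof.
move=> x1; rewrite /potential (bigD1 i) //= [X in _ <= X + _ + _](bigD1 i) //=.
under eq_bigr => j ji.
  rewrite /energy bias_rcons hits_rcons /=.
  have -> : (val i == val j) = false by rewrite (inj_eq val_inj) eq_sym (negbTE ji).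
  rewrite addr0 addn0 -/(energy h j).
  over.
have hK : 0 < (hits h i)%:R + K by rewrite ltr_wpDl.
have := @potential_step _ _ (bias T h i) x _ (y%:R - (val i)%:R / N%:R) _ hK x1
  (deviation_le1 y i) erefl.
have : ((hits h i)%:R + K)^-1 <= K^-1 by rewrite lef_pV2 ?posrE // lerDr.
rewrite /energy bias_rcons hits_rcons /= eqxx /slope -/N -/K.
rewrite natrD [_ + 1%:R + K]addrAC /residual /=.
lra.
Qed.

(** One supermartingale step. The factor is deterministic because [- g ^+ 2] has absorbed everything
    that depends on the slopes, leaving [1 / K] and the drift remainder of order [1 / N^2]. *)
Lemma potential_exp_step h x y : unit_contexts h -> dotp x x <= 1 ->
  \sum_(i < N.+1) weight h x i * expR (potential (rcons h ((x, y), val i)) / 36)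
  <= expR ((K^-1 + N%:R ^- 2 / 2) / 36) * expR (potential h / 36).
Proof.
move=> hc x1; have [w0 w1 wd] := weight_spec h x y.
apply: (@le_trans _ _ (expR ((potential h + K^-1) / 36) *
   \sum_(i < N.+1) weight h x i *
     expR ((2 * (slope T h x i * (y%:R - i%:R / N%:R)) - slope T h x i ^+ 2) / 36))).
  rewrite mulr_sumr; apply: ler_sum => i _; rewrite mulrCA; apply: ler_wpM2l => //.
  rewrite -expRD ler_expR; have := potential_rcons h y i x1; lra.
have -> : expR ((K^-1 + N%:R ^- 2 / 2) / 36) * expR (potential h / 36) =
    expR ((potential h + K^-1) / 36) * expR (N%:R ^- 2 / 72).
  by rewrite -!expRD; congr expR; lra.
apply: ler_wpM2l; first exact: expR_ge0.
apply: mixed_exponential => //.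
- move=> i; rewrite /slope; apply: slope_le1 => //; first by rewrite ltr_wpDl.
  apply: le_trans (bias_le_hits i hc) _.
  by rewrite lerXn2r ?nnegrE ?addr_ge0 ?(ltW K0) // lerDl ltW.
- by move=> i; apply: deviation_le1.
Qed.

Variable e : T.-tuple ('rV[R]_d * bool).
Implicit Type p : T.-tuple 'I_N.+1.

(** [zip] cuts the adversary's sequence to the length of [s], so that prefixes of the draws give
    prefixes of the history. *)
Definition history (s : seq 'I_N.+1) := zip e (map val s).

Definition next_weight (s : seq 'I_N.+1) (i : 'I_N.+1) : R :=
  weight (history s) (nth (0, false) e (size s)).1 i.

Lemma round_distE p (t : 'I_T) i :
  round_dist calibrator e p t i = next_weight (take t p) i.
Proof.
rewrite /round_dist /next_weight /weight /history map_take zip_take.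
by rewrite size_takel ?size_tuple 1?ltnW // -tnth_nth.
Qed.

Lemma calibrator_distributions : outputs_distributions calibrator N e.
Proof.
(* The outcome [false] is a dummy: the weights do not depend on it. *)
move=> p t; have [w0 w1 _] := weight_spec (history (take t p))
  (nth (0, false) e (size (take t p))).1 false.
split=> [i|]; first by rewrite round_distE; apply: w0.
by rewrite -[RHS]w1; apply: eq_bigr => i _; rewrite round_distE.
Qed.

Lemma draw_prob_ge0 p : 0 <= draw_prob calibrator e p.
Proof. by apply: prodr_ge0 => t _; have [] := calibrator_distributions p t. Qed.

Lemma draw_prob_le (G : seq 'I_N.+1 -> R) (rho : R) : 0 <= rho ->
  (forall s, (size s < T)%N ->
     \sum_i next_weight s i * G (rcons s i) <= rho * G s) ->
  \sum_(p : T.-tuple 'I_N.+1) draw_prob calibrator e p * G p <= rho ^+ T * G [::].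
Proof.
move=> rho0 wG; apply: le_trans (sequential_draws_le rho0 _ wG); last first.
  by move=> s i _; have [w0 _ _] := weight_spec (history s)
    (nth (0, false) e (size s)).1 false; apply: w0.
apply: ler_sum => p _; rewrite /draw_prob.
by under eq_bigr do rewrite round_distE.
Qed.

(** The supermartingale bound with [G = 1] gives total mass at most 1, and with [G = -1] at least
    1. *)
Lemma draw_prob_sum : \sum_(p : T.-tuple 'I_N.+1) draw_prob calibrator e p = 1.
Proof.
have next1 s : \sum_i next_weight s i = 1.
  by have [_ w1 _] := weight_spec (history s) (nth (0, false) e (size s)).1 false.
apply/eqP; rewrite eq_le; apply/andP; split.
  rewrite (eq_bigr (fun p => draw_prob calibrator e p * 1)) => [|p _]; last first.
    by rewrite mulr1.
  apply: le_trans (@draw_prob_le (fun=> 1) 1 ler01 _) _ => [s _|].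
    by rewrite -mulr_suml next1.
  by rewrite expr1n mulr1.
rewrite -lerN2 -sumrN.
rewrite (eq_bigr (fun p => draw_prob calibrator e p * -1)) => [|p _]; last first.
  by rewrite mulrN1.
apply: le_trans (@draw_prob_le (fun=> -1) 1 ler01 _) _ => [s _|].
  by rewrite -mulr_suml next1.
by rewrite expr1n mul1r.
Qed.

Hypothesis ae : admissible e.

Let ctx1 (t : nat) : (t < T)%N ->
  dotp (nth (0, false) e t).1 (nth (0, false) e t).1 <= 1.
Proof.
move=> tT; have [/norm2_le1] := ae (Ordinal tT).
by rewrite (tnth_nth (0, false)).
Qed.

Lemma history_contexts s : unit_contexts (history s).
Proof.
move=> ev; rewrite /history => /(nthP (0, false, 0%N))[k].
rewrite size_zip leq_min => /andP[k1 k2] <-.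
by rewrite nth_zip_cond size_zip leq_min k1 k2 /= ctx1 // -(size_tuple e).
Qed.

Definition final_potential p : R := potential (history p).

(** The accumulated logarithmic growth, [T (1 / K + N^-2 / 2)]. *)
Let B : R := N.+1%:R + T%:R * N%:R ^- 2 / 2.

Lemma potential_exp_moment :
  \sum_(p : T.-tuple 'I_N.+1)
     draw_prob calibrator e p * expR (final_potential p / 36) <= expR (B / 36).
Proof.
have := @draw_prob_le (fun s => expR (potential (history s) / 36))
  (expR ((K^-1 + N%:R ^- 2 / 2) / 36)) (expR_ge0 _).
have -> : expR ((K^-1 + N%:R ^- 2 / 2) / 36) ^+ T *
    expR (potential (history [::]) / 36) = expR (B / 36).
  have -> : potential (history [::]) = 0.
    rewrite /potential big1 // => i _.
    by rewrite /energy /history /= /bias; case: (tval e) => [|? ?];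
      rewrite /= big_nil dotp0l mul0r.
  rewrite mul0r expR0 mulr1 -expRM_natl; congr expR.
  rewrite /B /K invf_div; field.
  by rewrite !pnatr_eq0 -!lt0n T0 N0.
apply=> s sT; set x := nth (0, false) e (size s).
have := potential_exp_step x.2 (@history_contexts s) (ctx1 sT).
rewrite -/x; apply: le_trans; apply: ler_sum => i _.
rewrite /history map_rcons (zip_rcons_nth (0, false)) ?size_map ?size_tuple //.
by rewrite /next_weight -/x -surjective_pairing.
Qed.

Let normalized_exp_moment :
  \sum_(p : T.-tuple 'I_N.+1)
    draw_prob calibrator e p * expR (final_potential p / 36) / expR (B / 36) <= 1.
Proof. by rewrite -mulr_suml ler_pdivrMr ?expR_gt0 // mul1r potential_exp_moment. Qed.

(** By [1 + z <= exp z], the mean of [1 + (potential - B) / 36] is at most the normalized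
    exponential moment, hence at most 1. *)
Lemma potential_mean :
  \sum_(p : T.-tuple 'I_N.+1) draw_prob calibrator e p * final_potential p <= B.
Proof.
have : \sum_(p : T.-tuple 'I_N.+1)
     draw_prob calibrator e p * expR ((final_potential p - B) / 36) <= 1.
  apply: le_trans normalized_exp_moment.
  by apply: ler_sum => p _; rewrite -mulrA -expRN -expRD mulrBl.
move=> h.
have : \sum_(p : T.-tuple 'I_N.+1)
     draw_prob calibrator e p * (1 + (final_potential p - B) / 36) <= 1.
  apply: le_trans h; apply: ler_sum => p _; apply: ler_wpM2l; last exact: expR_ge1Dx.
  exact: draw_prob_ge0.
have -> : \sum_(p : T.-tuple 'I_N.+1)
     draw_prob calibrator e p * (1 + (final_potential p - B) / 36) =
   (1 - B / 36) * (\sum_(p : T.-tuple 'I_N.+1) draw_prob calibrator e p)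
   + (\sum_(p : T.-tuple 'I_N.+1) draw_prob calibrator e p * final_potential p) / 36.
  rewrite mulr_sumr mulr_suml -big_split; apply: eq_bigr => p _ /=.
  by field.
by rewrite draw_prob_sum; lra.
Qed.

(** Markov's inequality: where the event fails, [exp ((potential - B) / 36)] exceeds [1 / delta],
    and its mean is at most 1. *)
Lemma potential_tail (delta : R) : 0 < delta < 1 ->
  1 - delta <= Prob calibrator e
    (fun p => final_potential p <= B + 36 * ln (1 / delta)).
Proof.
move=> /andP[d0 d1].
rewrite /Prob lerBlDr -[leLHS]draw_prob_sum [leLHS](bigID (fun p =>
  final_potential p <= B + 36 * ln (1 / delta))) /= lerD2l.
have : \sum_(p : T.-tuple 'I_N.+1)
     delta * (draw_prob calibrator e p * expR (final_potential p / 36) / expR (B / 36))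
    <= delta by rewrite -mulr_sumr ler_piMr // ltW.
apply: le_trans.
rewrite [leRHS](bigID (fun p => final_potential p <= B + 36 * ln (1 / delta))) /=.
rewrite -[leLHS]add0r; apply: lerD.
  apply: sumr_ge0 => p _.
  by rewrite mulr_ge0 ?(ltW d0) // divr_ge0 ?expR_ge0 // mulr_ge0 ?expR_ge0 // draw_prob_ge0.
apply: ler_sum => p; rewrite -ltNge => hp.
rewrite -mulrA mulrCA; rewrite ler_peMr ?draw_prob_ge0 //.
rewrite -expRN -expRD -{1}[delta]lnK ?posrE // -expRD -[leLHS]expR0 ler_expR.
by move: hp; rewrite div1r lnV ?posrE //; lra.
Qed.

End Potential.


(** * From calibration to omniprediction *)

Section Losses.
Variables (R : realType) (l : R -> bool -> R).
Hypothesis hl : Lcvx l.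

Lemma unit_itvP (q : R) : unit_itv q <-> 0 <= q <= 1.
Proof. by rewrite /unit_itv /= in_itv. Qed.

Lemma loss_bound (q : R) (y : bool) : 0 <= q <= 1 -> -1 <= l q y <= 1.
Proof. by move=> hq; apply: hl.1; apply/unit_itvP. Qed.

Lemma loss_convex (t a b : R) (y : bool) :
  0 <= t <= 1 -> 0 <= a <= 1 -> 0 <= b <= 1 ->
  l (t * a + (1 - t) * b) y <= t * l a y + (1 - t) * l b y.
Proof.
move=> /andP[t0 t1] ha hb; have [/(_ (Itv01 t0 t1) a b) h _] := hl.2 y.
have := h; rewrite !inE => {}h.
by move/unit_itvP: ha => /h; move/unit_itvP: hb => hb /(_ hb); rewrite !convRE.
Qed.

Lemma loss_lipschitz (a b : R) (y : bool) : 0 <= a <= 1 -> 0 <= b <= 1 ->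
  `|l a y - l b y| <= `|a - b|.
Proof.
move=> ha hb; have [_ /(_ (a, b))] := hl.2 y.
by rewrite /= mul1r; apply; split; apply/unit_itvP.
Qed.

(** The slope is the supremum of the difference quotients to the left of [u]; by convexity these lie
    below all quotients to the right, and the Lipschitz condition bounds them by 1. *)
Lemma loss_subgradient (u : R) (y : bool) : 0 <= u <= 1 ->
  exists2 s, `|s| <= 1 & forall v, 0 <= v <= 1 -> l u y + s * (v - u) <= l v y.
Proof.
move=> /andP[]; rewrite le_eqVlt => /orP[/eqP<- _|u0 u1].
  (* At [u = 0] there are no left quotients, but slope [-1] works by the Lipschitz condition. *)
  exists (-1); first by rewrite normrN normr1.
  move=> v hv; have h0 : 0 <= (0 : R) <= 1 by rewrite lexx ler01.
  have := loss_lipschitz y h0 hv; rewrite sub0r normrN ler_norml.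
  by case/andP: hv => v0 v1; rewrite ger0_norm // => /andP[]; lra.
have hu : 0 <= u <= 1 by rewrite u1 ltW.
pose S : set R := [set (l u y - l v y) / (u - v) | v in [set v | 0 <= v < u]]%classic.
have slope v : 0 <= v < u -> `|(l u y - l v y) / (u - v)| <= 1.
  move=> /andP[v0 vu]; have hv : 0 <= v <= 1 by rewrite v0 (le_trans (ltW vu)).
  have uv : 0 < u - v by lra.
  rewrite normrM normfV (gtr0_norm uv) ler_pdivrMr // mul1r.
  by rewrite -[leRHS](gtr0_norm uv); apply: loss_lipschitz.
have S0 : S ((l u y - l 0 y) / (u - 0)) by exists 0 => //=; rewrite lexx.
have ubS b : (forall v, 0 <= v < u -> (l u y - l v y) / (u - v) <= b) -> sup S <= b.
  move=> hb; apply: ge_sup; first by exists ((l u y - l 0 y) / (u - 0)).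
  by move=> _ [v /= hv <-]; apply: hb.
have supS : has_sup S.
  split; first by exists ((l u y - l 0 y) / (u - 0)).
  exists 1 => _ [v /= hv <-]; exact: le_trans (ler_norm _) (slope v hv).
have leS v : 0 <= v < u -> (l u y - l v y) / (u - v) <= sup S.
  by move=> hv; apply: sup_upper_bound => //; exists v.
exists (sup S).
  rewrite ler_norml; apply/andP; split.
    have h00 : 0 <= (0 : R) < u by rewrite lexx.
    apply: le_trans (leS 0 h00).
    by have := slope 0 h00; rewrite ler_norml => /andP[].
  by apply: ubS => v hv; apply: le_trans (ler_norm _) (slope v hv).
move=> w hw; case: (ltgtP w u) => [wu|uw|->].
- have hv : 0 <= w < u by case/andP: hw => ->.
  have := leS w hv; rewrite ler_pdivrMr; last lra.
  by lra.
- have wu : 0 < w - u by lra.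
  suff : sup S <= (l w y - l u y) / (w - u).
    by rewrite ler_pdivlMr //; lra.
  apply: ubS => v /andP[v0 vu].
  have hv : 0 <= v <= 1 by rewrite v0 (le_trans (ltW vu)).
  have uv : 0 < u - v by lra.
  have wv : 0 < w - v by lra.
  rewrite ler_pdivrMr // mulrAC ler_pdivlMr //.
  (* The coefficient that writes [u] as a convex combination of [v] and [w]. *)
  have ht : 0 <= (w - u) / (w - v) <= 1.
    by rewrite divr_ge0 ?(ltW wu) ?(ltW wv) //= ler_pdivrMr // mul1r; lra.
  have := loss_convex y ht hv hw.
  have -> : (w - u) / (w - v) * v + (1 - (w - u) / (w - v)) * w = u.
    by field; rewrite gt_eqF.
  rewrite -(ler_pM2l wv).
  have -> : (w - v) * ((w - u) / (w - v) * l v y + (1 - (w - u) / (w - v)) * l w y)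
    = (w - u) * l v y + (u - v) * l w y by field; rewrite gt_eqF.
  by lra.
- by rewrite subrr mulr0 addr0.
Qed.

(* Replacing every [f i] by the mean [u] of [f] costs only the covariance of
   [f] with the outcomes, by the subgradient inequality at [u]. *)
Lemma bucket_regret (I : finType) (P : pred I) (f : I -> R) (y : I -> bool)
    (q kq : R) :
  0 <= q <= 1 -> 0 <= kq <= 1 ->
  (forall p, 0 <= p <= 1 -> expected_loss l q kq <= expected_loss l q p) ->
  (forall i, P i -> 0 <= f i <= 1) ->
  \sum_(i | P i) (l kq (y i) - l (f i) (y i)) <=
    6 * `|\sum_(i | P i) ((y i)%:R - q)| +
    2 * `|\sum_(i | P i) ((y i)%:R - q) * f i|.
Proof.
move=> hq hk opt hf.
set A := \sum_(i | P i) ((y i)%:R - q); set D := \sum_(i | P i) _ * _.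
pose n : R := #|P|%:R.
have [n0|n0] := posnP #|P|.
  rewrite big_pred0; last by apply/card0_eq.
  by rewrite addr_ge0 ?mulr_ge0.
have nR : 0 < n by rewrite ltr0n.
have sumc (c : R) : \sum_(i | P i) c = c * n.
  by rewrite sumr_const -mulr_natr.
pose u := (\sum_(i | P i) f i) / n.
have su : \sum_(i | P i) f i = u * n by rewrite /u divfK // gt_eqF.
have hu : 0 <= u <= 1.
  rewrite /u divr_ge0 ?(ltW nR) //=; last by apply: sumr_ge0 => i /hf /andP[].
  rewrite ler_pdivrMr // -sumc; apply: ler_sum => i /hf /andP[] //.
have [s1 s1b s1l] := loss_subgradient true hu.
have [s0 s0b s0l] := loss_subgradient false hu.
have Ele (p : R) : expected_loss l q p = q * l p true + (1 - q) * l p false.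
  by rewrite /expected_loss big_bool.
have := opt u hu; rewrite !Ele => {}opt.
(* Split each quantity into its mean under [q] plus a multiple of [y - q]. Then [c] is the mean
   regret of [kq] against [u], nonpositive by best response; [b] is the mean subgradient, whose term
   [b (u - f i)] sums to zero; [dlt] and [s1 - s0] multiply [y - q]. The constants come from
   [|dlt| <= 4] and [|s1 - s0| <= 2]. *)
pose dlt := (l kq true - l kq false) - (l u true - l u false).
pose c := (q * l kq true + (1 - q) * l kq false) - (q * l u true + (1 - q) * l u false).
pose b := s0 + q * (s1 - s0).
apply: (@le_trans _ _ (\sum_(i | P i)
   ((c + b * u) - b * f i + (dlt + (s1 - s0) * u) * ((y i)%:R - q)
      - (s1 - s0) * (((y i)%:R - q) * f i)))).
  apply: ler_sum => i /hf fi.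
  have := s1l _ fi; have := s0l _ fi; rewrite /c /b /dlt.
  by case: (y i) => /=; lra.
rewrite sumrB big_split sumrB /= sumc -!mulr_sumr -/A -/D su.
have c0 : c * n <= 0 by rewrite mulr_le0_ge0 ?(ltW nR) // /c; lra.
have d4 : `|dlt| <= 4.
  have := loss_bound true hk; have := loss_bound false hk.
  have := loss_bound true hu; have := loss_bound false hu.
  move=> /andP[? ?] /andP[? ?] /andP[? ?] /andP[? ?].
  by rewrite ler_norml /dlt; apply/andP; split; lra.
have s2 : `|s1 - s0| <= 2.
  by apply: le_trans (ler_normB _ _) _; lra.
have h1 : dlt * A <= 4 * `|A|.
  apply: le_trans (ler_norm _) _; rewrite normrM; exact: ler_wpM2r.
have h2 : (s1 - s0) * (u * A) <= 2 * `|A|.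
  apply: le_trans (ler_norm _) _; rewrite normrM; apply: ler_pM => //.
  by rewrite normrM ler_piMl // ger0_norm; case/andP: hu.
have h3 : - ((s1 - s0) * D) <= 2 * `|D|.
  apply: le_trans (ler_norm _) _; rewrite normrN normrM; exact: ler_wpM2r.
by lra.
Qed.

End Losses.

(** * Swap regret bounded by the bias vectors *)

Section Omniprediction.
Variables (R : realType) (T d : nat).
Let N := grid_size R calibrator T d.
Hypotheses (N0 : (0 < N)%N) (d0 : (0 < d)%N).
Variable e : T.-tuple ('rV[R]_d * bool).
Hypothesis ae : admissible e.
Variable k : (R -> bool -> R) -> R -> R.
Hypothesis hk : best_response (@Lcvx R) k.
Implicit Type p : T.-tuple 'I_N.+1.

Lemma historyE p : history e p =
  [seq (tnth e t, val (tnth p t)) | t <- enum 'I_T].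
Proof.
apply: (@eq_from_nth _ (0, false, 0%N)).
  by rewrite size_zip 2!size_map size_enum_ord !size_tuple minnn.
move=> t; rewrite size_zip size_map !size_tuple minnn => tT.
rewrite [RHS](nth_map (Ordinal tT)) ?size_enum_ord // nth_zip_cond.
rewrite size_zip size_map !size_tuple minnn tT.
rewrite (nth_map ord0) ?size_tuple //.
by rewrite !(tnth_nth (0, false)) !(tnth_nth ord0) nth_enum_ord.
Qed.

Lemma biasE p (i : 'I_N.+1) : bias T (history e p) i =
  \sum_(t < T | tnth p t == i)
     ((tnth e t).2%:R - (val i)%:R / N%:R) *: (tnth e t).1.
Proof. by rewrite /bias historyE big_map big_enum_cond. Qed.

Lemma hits_sum p : (\sum_(i < N.+1) hits (history e p) i)%N = T.
Proof.
rewrite /hits; under eq_bigr do rewrite -sum1_count historyE big_map big_enum_cond.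
rewrite -[RHS]card_ord -sum1_card (partition_big (tnth p) predT) //=.
Qed.

Let hypothesis_range (theta x : 'rV[R]_d) :
  norm2 theta <= 1 -> norm2 x <= 1 -> 0 <= (1 + dotp theta x) / 2 <= 1.
Proof.
move=> th x1; have := le_trans (dotp_le_norm2 theta x1) th.
by rewrite ler_norml => /andP[h1 h2]; apply/andP; split; lra.
Qed.

Let grid_range (i : 'I_N.+1) : 0 <= ((val i)%:R / N%:R : R) <= 1.
Proof.
rewrite divr_ge0 //= ler_pdivrMr ?ltr0n // mul1r ler_nat -ltnS; exact: ltn_ord.
Qed.

(** The first coordinate of every context is [1/2], so [V] also records the plain calibration error:
    [A = 2 V_0], whence [|A| <= 2 |V|]. The covariance is [D = (A + <V, theta>) / 2]. Thus
    [6 |A| + 2 |D| <= 7 |A| + |V| <= 15 |V|]. *)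
Lemma SOmni_le_bias p :
  (SOmni (@Lcvx R) (@Faff_res R d) k e p <=
   (15 * \sum_(i < N.+1) norm2 (bias T (history e p) i))%:E)%E.
Proof.
apply: ge_ereal_sup => _ [[l f] /= [hl hf] <-]; rewrite lee_fin.
rewrite (partition_big (tnth p) predT) //= mulr_sumr; apply: ler_sum => i _.
have [theta th fE] := hf i.
have [h1 h2] := hk (hl i) (proj2 (unit_itvP _) (grid_range i)).
set V := bias T (history e p) i.
have ctx t : norm2 (tnth e t).1 <= 1 by have [] := ae t.
have := @bucket_regret R (l i) (hl i) _ (fun t => tnth p t == i)
  (fun t => (1 + dotp theta (tnth e t).1) / 2) (fun t => (tnth e t).2)
  ((val i)%:R / N%:R) (k (l i) ((val i)%:R / N%:R)) (grid_range i)
  (proj1 (unit_itvP _) h1)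
  (fun q hq => h2 q (proj2 (unit_itvP _) hq))
  (fun t _ => hypothesis_range th (ctx t)).
set A := \sum_(t | _) _; set D := \sum_(t | _) _ * _ => reg.
apply: (@le_trans _ _ (6 * `|A| + 2 * `|D|)).
  apply: le_trans reg; rewrite le_eqVlt; apply/orP; left; apply/eqP.
  apply: eq_bigr => t /eqP ->; rewrite -fE.
  by case: (tnth e t) => x y.
have VA : V 0 (Ordinal d0) = A / 2.
  rewrite /V biasE summxE /A mulr_suml; apply: eq_bigr => t _.
  by rewrite mxE; have [_ ->] := ae t.
have AV : `|A| <= 2 * norm2 V.
  have := coord_le_norm2 V (Ordinal d0).
  by rewrite VA normrM (ger0_norm (_ : 0 <= 2^-1)) // ; lra.
have DV : D = A / 2 + dotp V theta / 2.
  rewrite dotpC /V biasE dotp_sumr /A !mulr_suml -big_split.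
  by apply: eq_bigr => t _; rewrite dotpZr /=; ring.
have Vt := dotp_le_norm2 V th.
have D2 : 2 * `|D| <= `|A| + `|dotp V theta|.
  rewrite -[X in X * _](ger0_norm (_ : 0 <= 2)) // -normrM.
  have -> : 2 * D = A + dotp V theta by rewrite DV; field.
  exact: ler_normD.
by lra.
Qed.

(** The trivial bound, for dimensions so large that the grid has its default size. *)
Lemma SOmni_le_rounds p :
  (SOmni (@Lcvx R) (@Faff_res R d) k e p <= (2 * T%:R)%:E)%E.
Proof.
apply: ge_ereal_sup => _ [[l f] /= [hl hf] <-]; rewrite lee_fin.
have -> : 2 * T%:R = \sum_(t < T) (2 : R).
  by rewrite sumr_const card_ord mulr_natr.
apply: ler_sum => t _; set i := tnth p t.
have [h1 _] := hk (hl i) (proj2 (unit_itvP _) (grid_range i)).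
have [theta th fE] := hf i.
have [ctx _] := ae t.
case: (tnth e t) ctx => x y /= ctx; rewrite -fE.
have := loss_bound (hl i) y (proj1 (unit_itvP _) h1).
have := loss_bound (hl i) y (hypothesis_range th ctx).
by move=> /andP[? ?] /andP[? ?]; rewrite /i in h1 *; lra.
Qed.

End Omniprediction.


(** * Rates *)

Section FinalBounds.
Variables (R : realType) (T d : nat).
Let N := grid_size R calibrator T d.
Hypotheses (T0 : (0 < T)%N) (N0 : (0 < N)%N).
Variable e : T.-tuple ('rV[R]_d * bool).
Implicit Type p : T.-tuple 'I_N.+1.

Let TR : 0 < T%:R :> R. Proof. by rewrite ltr0n. Qed.
Let NR : 0 < N%:R :> R. Proof. by rewrite ltr0n. Qed.

Definition bias_norms p : R := \sum_(i < N.+1) norm2 (bias T (history e p) i).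

(* AM-GM: the buckets have total mass [2 T] for the shifted counts
   [hits + T / (N + 1)]. *)
Lemma bias_norms_le p (theta : R) : 0 < theta ->
  bias_norms p <= T%:R * theta + final_potential e p / theta / 2.
Proof.
move=> th0; set h := history e p.
pose W i : R := (hits h i)%:R + T%:R / N.+1%:R.
have W0 i : 0 < W i by rewrite ltr_wpDl // divr_gt0 ?ltr0n.
have sW : \sum_(i < N.+1) W i = 2 * T%:R.
  rewrite /W big_split /= -natr_sum hits_sum sumr_const card_ord -[X in _ + X]mulr_natr.
  by rewrite divfK ?pnatr_eq0 //; ring.
have -> : T%:R * theta + final_potential e p / theta / 2 =
    \sum_(i < N.+1) (W i * theta / 2 + energy T h i / theta / 2).
  by rewrite big_split /= -!mulr_suml sW /final_potential /potential; lra.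
apply: ler_sum => i _; set v := norm2 _.
have -> : energy T h i = v ^+ 2 / W i by rewrite /energy /v sqr_sqrtr ?dotp_ge0.
have -> : W i * theta / 2 + v ^+ 2 / W i / theta / 2
    = v + (W i * theta - v) ^+ 2 / (2 * (W i * theta)).
  by field; rewrite !gt_eqF.
by rewrite lerDl divr_ge0 ?sqr_ge0 // !mulr_ge0 // ltW.
Qed.

Let B : R := N.+1%:R + T%:R * N%:R ^- 2 / 2.

Hypothesis cubeN : (N ^ 3 <= T)%N.

(** As [N^3 <= T], one has [N + 1 <= 2 N <= 2 T / N^2]. The factor [1 / N] is kept apart because [B]
    will be divided by some [theta >= 1 / N]. *)
Let B_le : B <= N%:R^-1 * (5 / 2 * (T%:R / N%:R)).
Proof.
have h : N%:R ^+ 3 <= T%:R :> R by rewrite -natrX ler_nat.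
have -> : N%:R^-1 * (5 / 2 * (T%:R / N%:R)) =
    2 * (T%:R / N%:R ^+ 2) + T%:R * N%:R ^- 2 / 2 :> R.
  by field; rewrite gt_eqF.
rewrite /B lerD2r; apply: (@le_trans _ _ (2 * N%:R)).
  have : 1 <= N%:R :> R by rewrite ler1n.
  by rewrite -natr1; lra.
rewrite ler_pM2l // ler_pdivlMr ?exprn_gt0 // -exprS.
Qed.

Lemma bias_norms_tail p (L : R) : 0 <= L ->
  final_potential e p <= B + 36 * L ->
  bias_norms p <= 9 / 4 * (T%:R / N%:R) + 19 * Num.sqrt (T%:R * L).
Proof.
move=> L0 hP; set z := Num.sqrt (T%:R * L).
(* The two summands of [theta] balance the two parts of the potential bound: [1 / N] for [B], and
   [r] for [L], where [T r = z] and [L = r z]. *)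
pose r := Num.sqrt (L / T%:R); pose theta := N%:R^-1 + r.
have r0 : 0 <= r by exact: sqrtr_ge0.
have z0 : 0 <= z by exact: sqrtr_ge0.
have zr : T%:R * r = z.
  have -> : z = Num.sqrt ((T%:R * r) ^+ 2).
    congr Num.sqrt; rewrite exprMn sqr_sqrtr ?divr_ge0 ?(ltW TR) //.
    by field; rewrite gt_eqF.
  by rewrite sqrtr_sqr ger0_norm // mulr_ge0 // ltW.
have Lr : L = r * z.
  rewrite -zr mulrCA -expr2 sqr_sqrtr ?divr_ge0 ?(ltW TR) //.
  by field; rewrite gt_eqF.
have th0 : 0 < theta by rewrite ltr_wpDr // invr_gt0.
have x0 : 0 <= T%:R / N%:R :> R by rewrite divr_ge0.
apply: le_trans (bias_norms_le p th0) _.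
have -> : T%:R * theta = T%:R / N%:R + z by rewrite /theta mulrDr zr.
suff : final_potential e p / theta <= 5 / 2 * (T%:R / N%:R) + 36 * z by lra.
rewrite ler_pdivrMr //; apply: le_trans hP _.
rewrite /theta {1}Lr; have := B_le.
have : 0 <= r * (T%:R / N%:R) by rewrite mulr_ge0.
have : 0 <= N%:R^-1 * z by rewrite mulr_ge0 ?invr_ge0.
by lra.
Qed.

(** Here [theta = 1 / N]: the bound is [T / N] plus [N / 2] times the mean potential, at most
    [5/4 * T / N]. *)
Lemma bias_norms_mean : admissible e ->
  \sum_(p : T.-tuple 'I_N.+1) draw_prob calibrator e p * bias_norms p
  <= 9 / 4 * (T%:R / N%:R).
Proof.
move=> ae.
apply: (@le_trans _ _ (\sum_(p : T.-tuple 'I_N.+1) (T%:R / N%:R * draw_prob calibrator e p +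
   N%:R / 2 * (draw_prob calibrator e p * final_potential e p)))).
  apply: ler_sum => p _.
  have := bias_norms_le p (_ : 0 < N%:R^-1); rewrite invr_gt0 NR invrK.
  move=> /(_ isT) /(ler_wpM2l (draw_prob_ge0 T0 N0 e p)) /le_trans; apply.
  by rewrite le_eqVlt; apply/orP; left; apply/eqP; ring.
rewrite big_split /= -!mulr_sumr draw_prob_sum // mulr1.
have := potential_mean T0 N0 ae; rewrite -/N -/B => h.
have : N%:R / 2 * (\sum_(p : T.-tuple 'I_N.+1)
    draw_prob calibrator e p * final_potential e p) <= N%:R / 2 * B.
  by apply: ler_wpM2l h; rewrite divr_ge0.
have : N%:R / 2 * B <= 5 / 4 * (T%:R / N%:R).
  have -> : 5 / 4 * (T%:R / N%:R) = N%:R / 2 * (N%:R^-1 * (5 / 2 * (T%:R / N%:R))) :> R.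
    by field; rewrite gt_eqF.
  by apply: ler_wpM2l B_le; rewrite divr_ge0.
by lra.
Qed.

End FinalBounds.

(** * Comparison of the grid size with the stated rates *)

Lemma half_le_ln2 (R : realType) : 1 / 2 <= ln 2 :> R.
Proof.
have h : expR (1 / 2) <= 2 :> R.
  rewrite -[expR _]invrK -expRN -[leRHS]invrK lef_pV2 ?posrE ?expR_gt0 ?invr_gt0 //.
  by have := expR_ge1Dx (- (1 / 2) : R); lra.
by rewrite -[leLHS]expRK ler_ln ?posrE ?expR_gt0.
Qed.

(** Take logarithms in [T < 2 ^ l <= 2 T] and use [1/2 <= ln 2 <= 1] together with
    [ln (2 T) <= 2 ln T]. *)
Lemma ln_log2_bounds (R : realType) (T l : nat) :
  (2 <= T)%N -> (T < 2 ^ l <= 2 * T)%N ->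
  ln T%:R <= l%:R :> R /\ l%:R <= 4 * ln T%:R :> R.
Proof.
move=> T2 /andP[l1 l2].
have T0 : 0 < T%:R :> R by rewrite ltr0n; lia.
have ln2 := half_le_ln2 R.
have ln21 : ln 2 <= 1 :> R by have := @le_ln1Dx R 1; rewrite -natr1 /=; apply.
have Tln : ln 2 <= ln T%:R :> R by rewrite ler_ln ?posrE // ler_nat.
have l0 : 0 <= l%:R :> R by [].
have p2 : 0 < (2 ^ l)%:R :> R by rewrite ltr0n expn_gt0.
have pT : 0 < (2 * T)%:R :> R by rewrite natrM mulr_gt0.
have e2 : ln (2 ^ l)%:R = l%:R * ln 2 :> R by rewrite natrX lnXn // mulr_natl.
split.
  apply: (@le_trans _ _ (ln (2 ^ l)%:R)).
    by rewrite ler_ln ?posrE // ler_nat ltnW.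
  by rewrite e2 ler_piMr.
have : ln (2 ^ l)%:R <= ln (2 * T)%:R :> R.
  by rewrite ler_ln ?posrE // ler_nat.
rewrite e2 natrM lnM ?posrE // => h.
have : l%:R * (1 / 2) <= l%:R * ln 2 :> R by apply: ler_wpM2l.
by lra.
Qed.

Lemma powR_third_cubed (R : realType) (x : R) : 0 <= x -> (x `^ (1 / 3)) ^+ 3 = x.
Proof.
by move=> x0; rewrite -powR_mulrn ?powR_ge0 // -powRrM mul1r mulVf // powRr1.
Qed.

(** Compare cubes: [T < (N + 1)^3 d l <= 8 N^3 d (4 ln T)] gives [(T / N)^3 <= 32 T^2 d ln T], and
    [32 <= 4^3]. *)
Lemma rate_lower_bound (R : realType) (T d l N : nat) :
  (2 <= T)%N -> (1 <= d)%N -> (0 < N)%N -> (T < 2 ^ l <= 2 * T)%N ->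
  (T < N.+1 ^ 3 * (d * l))%N ->
  T%:R / N%:R <= 4 * (T%:R `^ (2 / 3) * d%:R `^ (1 / 3) * (ln T%:R) `^ (1 / 3)) :> R.
Proof.
move=> T2 d1 N0 hl hN; have [_ l4] := ln_log2_bounds R T2 hl.
have T0 : 0 < T%:R :> R by rewrite ltr0n; lia.
have NR : 0 < N%:R :> R by rewrite ltr0n.
have L0 : 0 <= ln T%:R :> R by rewrite ln_ge0 // ler1n; lia.
set a := _ * _ * _.
have a0 : 0 <= a by rewrite !mulr_ge0 ?powR_ge0.
have a3 : a ^+ 3 = T%:R ^+ 2 * d%:R * ln T%:R.
  rewrite /a !exprMn !powR_third_cubed //; congr (_ * _ * _).
  by rewrite -[LHS]powR_mulrn ?powR_ge0 // -powRrM divfK // powR_mulrn // ltW.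
have a40 : 0 <= 4 * a by rewrite mulr_ge0.
rewrite -(@ler_pXn2r _ 3) ?nnegrE ?divr_ge0 //.
rewrite expr_div_n exprMn a3 ler_pdivrMr ?exprn_gt0 //.
have h : T%:R <= 8 * N%:R ^+ 3 * (d%:R * (4 * ln T%:R)) :> R.
  apply: (@le_trans _ _ (8 * N%:R ^+ 3 * (d%:R * l%:R))).
    rewrite -(natrX _ N) -!natrM ler_nat; apply: leq_trans (ltnW hN) _.
    rewrite leq_mul2r -[8%N]/(2 ^ 3)%N -expnMn leq_exp2r //; apply/orP; right; lia.
  by rewrite !ler_wpM2l // ?mulr_ge0 ?exprn_ge0.
have -> : 4 ^+ 3 * (T%:R ^+ 2 * d%:R * ln T%:R) * N%:R ^+ 3 =
   2 * (T%:R ^+ 2 * (8 * N%:R ^+ 3 * (d%:R * (4 * ln T%:R)))) :> R by ring.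
have := ler_wpM2l (sqr_ge0 (T%:R : R)) h; rewrite -exprSr.
have : 0 <= T%:R ^+ 2 * (8 * N%:R ^+ 3 * (d%:R * (4 * ln T%:R))) :> R.
  by rewrite !mulr_ge0.
by lra.
Qed.

(** Write [sqrt T] as [T^(2/3) T^(-1/6)] and use [d ln T <= d l <= T] in the negative power. *)
Lemma deviation_lower_bound (R : realType) (T d l : nat) (L : R) :
  (2 <= T)%N -> (1 <= d)%N -> (T < 2 ^ l <= 2 * T)%N -> (d * l <= T)%N ->
  Num.sqrt (T%:R * L) <=
    T%:R `^ (2 / 3) * (d%:R * ln T%:R) `^ (- (1 / 6)) * Num.sqrt L.
Proof.
move=> T2 d1 hl dl; have [lT _] := ln_log2_bounds R T2 hl.
have T0 : 0 < T%:R :> R by rewrite ltr0n; lia.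
have D0 : 0 < d%:R * ln T%:R :> R.
  by rewrite mulr_gt0 ?ltr0n ?ln_gt0 // ltr1n.
rewrite sqrtrM ?(ltW T0) // ler_wpM2r ?sqrtr_ge0 //.
have -> : Num.sqrt T%:R = T%:R `^ (2 / 3) * T%:R `^ (- (1 / 6)) :> R.
  rewrite -powRD; last by apply/implyP => _; rewrite gt_eqF.
  by rewrite -powR12_sqrt ?(ltW T0) //; congr powR; field.
rewrite ler_wpM2l ?powR_ge0 // !powRN lef_pV2 ?posrE ?powR_gt0 //.
apply: ge0_ler_powR; rewrite ?nnegrE ?(ltW D0) ?(ltW T0) //.
apply: (@le_trans _ _ (d%:R * l%:R)); first by rewrite ler_wpM2l.
by rewrite -natrM ler_nat.
Qed.

(** * Assembly of the high-probability and expectation bounds *)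

Theorem theorem2 (R : realType) :
  exists2 C : R, 0 < C &
  exists2 A : forecaster, efficient R A &
  forall T d : nat, (2 <= T)%N -> (1 <= d)%N ->
  let N := grid_size R A T d in
  let a := T%:R `^ (2 / 3) * d%:R `^ (1 / 3) * (ln T%:R) `^ (1 / 3) : R in
  let b := T%:R `^ (2 / 3) * (d%:R * ln T%:R) `^ (- (1 / 6)) : R in
  (0 < N)%N /\
  forall e : T.-tuple ('rV[R]_d * bool), admissible e ->
    outputs_distributions A N e /\
    forall k : (R -> bool -> R) -> R -> R, best_response (@Lcvx R) k ->
    let S := fun p : T.-tuple 'I_N.+1 =>
      SOmni (@Lcvx R) (@Faff_res R d) k e p in
    (forall delta : R, 0 < delta < 1 ->
       1 - delta <=
       Prob A e (fun p => (S p <= (C * (a + b * Num.sqrt (ln (1 / delta))))%:E)%E)) /\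
    (Expect A e S <= (C * a)%:E)%E.
Proof.
(* The argument needs [15 * 9/4 * 4 = 135] in front of [a] and [15 * 19 = 285] in front of [b]. *)
exists 300 => //; exists calibrator; first exact: calibrator_efficient.
move=> T d T2 d1 N a b.
have T0 : (0 < T)%N by apply: ltnW.
have [l [/andP[N0 NT] hl hN hN1]] := grid_size_spec R T0 d1.
split=> // e ae; split; first exact: calibrator_distributions.
move=> k hk S.
have xa : T%:R / N%:R <= 4 * a by exact: rate_lower_bound hl hN1.
have a0 : 0 <= a by rewrite !mulr_ge0 ?powR_ge0.
have b0 : 0 <= b by rewrite mulr_ge0 ?powR_ge0.
have P0 (p : T.-tuple 'I_N.+1) : 0 <= draw_prob calibrator e p.
  exact: draw_prob_ge0.
have P1 : \sum_(p : T.-tuple 'I_N.+1) draw_prob calibrator e p = 1.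
  exact: draw_prob_sum.
have ExpectS (F : T.-tuple 'I_N.+1 -> R) : (forall p, (S p <= (F p)%:E)%E) ->
    (Expect calibrator e S <=
      (\sum_(p : T.-tuple 'I_N.+1) draw_prob calibrator e p * F p)%:E)%E.
  move=> SF; rewrite /Expect -sumEFin; apply: lee_sum => p _.
  by rewrite EFinM lee_wpmul2l ?lee_fin.
(* In the second case [N] is the default 1, so [T <= 4 a] and the trivial bound [2 T] is already of
   the right order. *)
have [small|large] := leqP (N ^ 3 * (d * l)) T; last first.
  have N1 : N = 1%N by case: hN => // hN; move: large; rewrite ltnNge hN.
  have Sa p : (S p <= (300 * a)%:E)%E.
    apply: le_trans (SOmni_le_rounds N0 ae hk p) _.
    by move: xa; rewrite N1 divr1 lee_fin; lra.
  split.
    move=> delta /andP[dl0 _]; apply: (@le_trans _ _ 1); first by rewrite gerBl ltW.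
    rewrite -[leLHS]P1 /Prob le_eqVlt; apply/orP; left; apply/eqP; apply: eq_bigl => p.
    apply/esym/idP; apply: le_trans (Sa p) _; rewrite lee_fin.
    by have := mulr_ge0 b0 (sqrtr_ge0 (ln (1 / delta))); lra.
  by apply: le_trans (ExpectS _ Sa) _; rewrite -mulr_suml P1 mul1r.
have l0 : (0 < l)%N by case: (l) hl => //; rewrite expn0; lia.
have dl0 : (0 < d * l)%N by rewrite muln_gt0 d1.
have cubeN : (N ^ 3 <= T)%N by apply: leq_trans small; apply: leq_pmulr.
have dlT : (d * l <= T)%N by apply: leq_trans small; apply: leq_pmull; rewrite expn_gt0 N0.
split.
  move=> delta hd; apply: le_trans (potential_tail T0 N0 ae hd) _.
  have L0 : 0 <= ln (1 / delta).
    by case/andP: hd => ? ?; rewrite ln_ge0 // div1r invf_ge1 // ltW.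
  (* Draws with small potential satisfy the regret bound, and the remaining ones contribute
     nonnegative mass. *)
  rewrite /Prob [leRHS](bigID (fun p => final_potential e p <=
    N.+1%:R + T%:R * N%:R ^- 2 / 2 + 36 * ln (1 / delta))) /=.
  rewrite -[leLHS]addr0; apply: lerD; last by apply: sumr_ge0.
  rewrite le_eqVlt; apply/orP; left; apply/eqP; apply: eq_bigl => p.
  case: (boolP (final_potential _ _ <= _)) => [hp|]; last by rewrite andbF.
  rewrite andbT; apply/esym/idP.
  apply: le_trans (SOmni_le_bias N0 d1 ae hk p) _; rewrite lee_fin.
  have := bias_norms_tail T0 N0 cubeN L0 hp.
  have := deviation_lower_bound (ln (1 / delta)) T2 d1 hl dlT.
  rewrite -/b /bias_norms -/N => h1 h2.
  by have := mulr_ge0 b0 (sqrtr_ge0 (ln (1 / delta))); lra.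
apply: le_trans (ExpectS _ (SOmni_le_bias N0 d1 ae hk)) _.
rewrite lee_fin; under eq_bigr do rewrite mulrCA.
rewrite -mulr_sumr.
have := bias_norms_mean T0 N0 cubeN ae; rewrite /bias_norms -/N => h; lra.
Qed.
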